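(* Let $\mathfrak{g}$ be a complex reductive Lie algebra with Cartan subalgebra $\mathfrak{t}$, fix a choice of positive roots, and let $N$ be the number of positive roots. For each integer $k\ge 0$ we have $\deg\mathbf{P}_k\le N+k$ and $\deg\mathbf{E}_k\le k(N+1)$. If moreover $\mathfrak{g}$ is semisimple, then $$\deg\mathbf{E}_k\le\left\lfloor\frac{k}{2}\right\rfloor N+k.$$
   Context: $\Lambda\subset\mathfrak{t}^*$ is the set of $\mu\in\mathfrak{t}^*$ integer-valued on all coroots and $\Lambda^+\subset\Lambda$ the dominant elements. For $\lambda\in\Lambda^+$, $\phi_\lambda$ is the irreducible finite-dimensional representation of $\mathfrak{g}$ of highest weight $\lambda$, and $m_\phi(\mu)$ is the multiplicity of $\mu$ as a weight of a representation $\phi$. Put $\mathbb{S}^k=\mathrm{Sym}^k_{\mathbb{C}}(\mathfrak{t}^* )$ and $$P_k(\phi)=\sum_\mu m_\phi(\mu)\mu^k\in\mathbb{S}^k,\qquad E(\phi)=\prod_\mu(1+\mu)^{m_\phi(\mu)},$$ and let $E_k(\phi)\in\mathbb{S}^k$ be the degree $k$ term of $E(\phi)$. The functions $\lambda\mapsto P_k(\phi_\lambda)$ and $\lambda\mapsto E_k(\phi_\lambda)$ on $\Lambda^+$ extend uniquely to polynomial functions $\mathfrak{t}^*\to\mathbb{S}^k$, denoted $\mathbf{P}_k$ and $\mathbf{E}_k$. They are regarded as elements of $\mathcal{A}=\mathrm{Sym}_{\mathbb{C}}(\mathfrak{t}^*\oplus\mathfrak{t})=\mathrm{Sym}_{\mathbb{C}}(\mathfrak{t}^*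 )\otimes\mathrm{Sym}_{\mathbb{C}}(\mathfrak{t})$, viewed as the algebra of $\mathrm{Sym}_{\mathbb{C}}(\mathfrak{t}^* )$-valued polynomials on $\mathfrak{t}^*$. For $f=\sum_{i,j}f_{i,j}\in\mathcal{A}$ with $f_{i,j}\in\mathrm{Sym}^i(\mathfrak{t}^* )\otimes\mathrm{Sym}^j(\mathfrak{t})$, $\deg(f)=\max\{j\mid\exists i,\ f_{i,j}\neq0\}$, i.e. the degree of $f$ as a polynomial function of $\lambda\in\mathfrak{t}^*$ (with $\deg 0=-\infty$). *)

(* Defs.v *)
From HB Require Import structures.
From mathcomp Require Import all_boot all_order all_algebra.
From mathcomp Require Import finmap complex.
From mathcomp Require Import classical_sets fsbigop reals.
From mathcomp Require Import mpoly.

Set Implicit Arguments.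
Unset Strict Implicit.
Unset Printing Implicit Defensive.

Import Order.TTheory GRing.Theory Num.Theory.
Local Open Scope ring_scope.

(* The bracket is carried by its adjoint map x |-> [x, -], which makes it
   bilinear by construction. *)
Record lieAlgebra (F : fieldType) := LieAlgebra {
  lie_sort :> vectType F;
  lie_ad : {linear lie_sort -> 'End(lie_sort)};
  lie_alt : forall x, lie_ad x x = 0;
  lie_jacobi : forall x y z,
    lie_ad x (lie_ad y z) + lie_ad y (lie_ad z x) + lie_ad z (lie_ad x y) = 0 }.

Definition lie_br (F : fieldType) (g : lieAlgebra F) (x y : g) : g :=
  lie_ad g x y.

Record lieRep (F : fieldType) (g : lieAlgebra F) := LieRep {
  rep_sort :> vectType F;
  rep_act : {linear g -> 'End(rep_sort)};
  rep_br : forall x y,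
    rep_act (lie_br x y) =
      (rep_act x \o rep_act y)%VF - (rep_act y \o rep_act x)%VF }.

Section LieAlgebras.
Variables (F : fieldType) (g : lieAlgebra F).

Lemma lie_brC (x y : g) : lie_br x y = - lie_br y x.
Proof.
apply/eqP; rewrite -addr_eq0 /lie_br; apply/eqP.
have := lie_alt (x + y); rewrite linearD (linearD (lie_ad g)) /= !add_lfunE.
by rewrite !lie_alt add0r addr0 addrC.
Qed.

Lemma lie_ad_br (x y : g) :
  lie_ad g (lie_br x y) =
    (lie_ad g x \o lie_ad g y)%VF - (lie_ad g y \o lie_ad g x)%VF.
Proof.
apply/lfunP => z; rewrite add_lfunE opp_lfunE !comp_lfunE /=.
have J := lie_jacobi x y z.
have E1 : lie_ad g z (lie_ad g x y) = - lie_ad g (lie_br x y) z.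
  exact: (lie_brC z (lie_br x y)).
have E2 : lie_ad g z x = - lie_ad g x z by exact: (lie_brC z x).
by move/eqP: J; rewrite E1 E2 linearN /= subr_eq0 => /eqP <-.
Qed.

Definition adjoint_rep : lieRep g := LieRep lie_ad_br.

Definition lie_brv (U W : {vspace g}) : {vspace g} :=
  <<[seq lie_br x y | x <- vbasis U, y <- vbasis W]>>%VS.

Definition lie_ideal (I : {vspace g}) : Prop :=
  forall x y, y \in I -> lie_br x y \in I.

Definition lie_solvable (I : {vspace g}) : Prop :=
  exists n, iter n (fun U => lie_brv U U) I = 0%VS.

(* The adjoint representation is completely reducible. *)
Definition reductive : Prop :=
  forall I, lie_ideal I ->
    exists J, [/\ lie_ideal J, (I + J = fullv)%VS & (I :&: J = 0)%VS].

Definition semisimple : Prop :=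
  forall I, lie_ideal I -> lie_solvable I -> I = 0%VS.

(* Cartan subalgebras of a complex reductive Lie algebra: the maximal abelian
   subalgebras all of whose elements act diagonalizably on g. *)
Definition cartan_subalgebra (t : {vspace g}) : Prop :=
  [/\ {in t &, forall x y, lie_br x y = 0},
      forall x, {in t, forall h, lie_br h x = 0} -> x \in t
    & {in t, forall h, exists2 e : seq g, basis_of fullv e
        & {in e, forall x, exists c : F, lie_br h x = c *: x}}].

Definition irreducible (V : lieRep g) : Prop :=
  (fullv : {vspace V}) <> 0%VS /\
  forall W : {vspace V},
    (forall x, {in W, forall v, rep_act V x v \in W}) -> W = 0%VS \/ W = fullv.

End LieAlgebras.

Section Weights.
Variables (F : fieldType) (g : lieAlgebra F) (t : {vspace g}).
Local Notation tdual := 'Hom(subvs_of t, F^o).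
Implicit Types (V : lieRep g) (mu alpha : tdual) (h : subvs_of t).

Definition rk : nat := \dim {: subvs_of t}.

Definition tbasis : rk.-tuple (subvs_of t) := vbasis fullv.

Definition weight_space V mu : {vspace V} :=
  (\bigcap_(i < rk)
     passmx.leigenspace (rep_act V (vsval (tnth tbasis i))) (mu (tnth tbasis i)))%VS.

Lemma mem_weight_space V mu v :
  v \in weight_space V mu <->
  forall h, rep_act V (vsval h) v = (mu h : F) *: v.
Proof.
have eigE (f : 'End(V)) a : (v \in passmx.leigenspace f a) = (f v == a *: v).
  by rewrite memv_ker add_lfunE opp_lfunE scale_lfunE id_lfunE subr_eq0.
have capE (A : 'I_rk -> {vspace V}) :
    v \in (\bigcap_(i < rk) A i)%VS <-> forall i, v \in A i.
  rewrite memvE; split=> [/subv_bigcapP sA i|sA].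
    by rewrite memvE sA.
  by apply/subv_bigcapP => i _; rewrite -memvE.
split=> [/capE wv h|wv]; last by apply/capE => i; rewrite eigE wv.
rewrite (coord_vbasis (memvf h)) !linear_sum /= sum_lfunE scaler_suml.
apply: eq_bigr => i _; rewrite !linearZ /= scale_lfunE.
have := wv i; rewrite eigE (tnth_nth 0) => /eqP ->.
by rewrite scalerA.
Qed.

Definition mult V mu : nat := \dim (weight_space V mu).

Definition root alpha : Prop :=
  alpha <> 0 /\ (0 < mult (adjoint_rep g) alpha)%N.

(* The coroot of alpha is the unique h in [g_alpha, g_(-alpha)] such that
   alpha(h) = 2. *)
Definition is_coroot alpha h : Prop :=
  vsval h \in lie_brv (weight_space (adjoint_rep g) alpha)
                      (weight_space (adjoint_rep g) (- alpha))
  /\ alpha h = 2%:R.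

(* The element of Sym(t^* ) defined by mu, where Sym(t^* ) is identified with
   {mpoly F[rk]}: the variables are the basis of t^* dual to [tbasis]. *)
Definition tsym mu : {mpoly F[rk]} :=
  \sum_(i < rk) (mu (tnth tbasis i) : F) *: 'X_i.

Local Open Scope classical_set_scope.

(* The following sum and product range over all of t^*; their supports are
   finite. *)
Definition power_sum k V : {mpoly F[rk]} :=
  \sum_(mu \in [set: tdual]) tsym mu ^+ k *+ mult V mu.

Definition total_class V : {mpoly F[rk]} :=
  \big[*%R/1]_(mu \in [set: tdual]) (1 + tsym mu) ^+ mult V mu.

Definition elem_sum k V : {mpoly F[rk]} := pihomog mdeg k (total_class V).

Local Close Scope classical_set_scope.

(* Sym(t^* + t) = Sym(t^* ) (x) Sym(t), as the algebra of polynomials in the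
   basis [tbasis] of t -- the coordinates on t^* -- with coefficients in
   Sym(t^* ).  Hence [msize] is the size with respect to Sym(t) only. *)
Definition symA := {mpoly {mpoly F[rk]}[rk]}.

Definition symA_eval (f : symA) (lambda : tdual) : {mpoly F[rk]} :=
  f.@[fun i => (lambda (tnth tbasis i) : F)%:MP].

(* [msize] is one more than the degree, and 0 for the zero polynomial, so that
   the bound holds for deg 0 = -oo. *)
Definition deg_le (f : symA) (d : nat) : Prop := (msize f <= d.+1)%N.

End Weights.

Section Positivity.
Variables (F : numFieldType) (g : lieAlgebra F) (t : {vspace g}).
Local Notation tdual := 'Hom(subvs_of t, F^o).
Implicit Types (Phip : {fset tdual}) (lambda alpha : tdual).

(* The positive roots attached to a Weyl chamber: those which are positive at
   an element h of t at which all roots are real and nonzero.  In a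
   [numFieldType], 0 < z and z < 0 entail that z is real. *)
Definition positive_roots Phip : Prop :=
  exists h : subvs_of t,
    (forall alpha, root alpha -> 0 < (alpha h : F) \/ (alpha h : F) < 0) /\
    (forall alpha, alpha \in Phip <-> root alpha /\ 0 < (alpha h : F)).

Definition integral lambda : Prop :=
  forall alpha h, root alpha -> is_coroot alpha h ->
    exists z : int, lambda h = z%:~R.

Definition dominant Phip lambda : Prop :=
  integral lambda /\
  forall alpha h, alpha \in Phip -> is_coroot alpha h -> 0 <= (lambda h : F).

Definition highest_weight Phip (V : lieRep g) lambda : Prop :=
  exists v : V, [/\ v != 0, v \in weight_space V lambda
    & forall alpha x, alpha \in Phip ->
        x \in weight_space (adjoint_rep g) alpha -> rep_act V x v = 0].

(* [f] is a polynomial function on t^* extending phi on the dominant integral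
   elements. *)
Definition extends_dominant Phip (f : symA t) (phi : tdual -> {mpoly F[rk t]})
    : Prop :=
  forall lambda, dominant Phip lambda -> symA_eval f lambda = phi lambda.

End Positivity.

(* Main.v *)
Require Import Defs.
From HB Require Import structures.
From mathcomp Require Import all_boot all_order all_algebra.
From mathcomp Require Import finmap complex.
From mathcomp Require Import boolp classical_sets fsbigop reals.
From mathcomp Require Import mpoly.
From mathcomp Require Import ring zify.

Set Implicit Arguments.
Unset Strict Implicit.
Unset Printing Implicit Defensive.

Import Order.TTheory GRing.Theory Num.Theory.
Local Open Scope ring_scope.

(* The degrees are read off from growth along rays.  Fix lambda dominant.  By
   the sl2-theory of the root triples, in a product of powers f_1^a_1 ... f_N^a_N
   of negative root vectors acting without annihilating it on a highest weight
   vector of weight m lambda, every a_i is O(m).  As these products span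
   phi_(m lambda), its dimension is O(m^N) and its weights are O(m), so
   P_k(phi_(m lambda)) = O(m^(N + k)) and the components of P_k of degree
   j > N + k vanish at lambda.  The dominant elements are Zariski dense in t^*,
   hence these components are zero.  The bounds for E_k follow by Newton's
   identities; when g is semisimple, g = [g, g] forces P_1 = 0, so that every
   product of power sums contributing to E_k has at most k/2 factors. *)

(** * Traces and common eigenvectors *)

(** No character or dimension formula is used. The sl2-theory rests on one fact: a commutator has
    trace zero on a finite-dimensional subspace stable under both factors. Applied to suitable
    strings of weight spaces, it yields one-dimensional root spaces, integrality of the roots on the
    coroots, and the relation between the two string lengths that bounds the exponents. The delicate
    point is that these bounds are linear in m. How often a negative root vector can act without
    annihilating depends on the word it acts on, so the exponents are controlled one letter at a
    time, beginning with the letters that act first. The constant grows geometrically with the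
    number of letters but does not involve m, and only orders of growth matter afterwards. Scalars
    are compared only when they are known to be real, and the archimedean axiom serves both to round
    weights to integral ones and to turn a growth rate into a bound on the degree. *)

Section LinearAlgebra.
Variables (F : fieldType) (V : vectType F).
Implicit Types (u v : 'End(V)) (W : {vspace V}).

Lemma free_subseq_span (X : seq V) :
  exists Y : seq V, [/\ {subset Y <= X}, free Y & (<<Y>> = <<X>>)%VS].
Proof.
elim: X => [|x X [Y [sYX fY eY]]]; first by exists [::]; split=> //; rewrite nil_free.
have [xY|xY] := boolP (x \in <<Y>>%VS).
  exists Y; split=> //; first by move=> y /sYX yX; rewrite inE yX orbT.
  rewrite span_cons -eY; apply/esym/addv_idPr; exact: xY.
exists (x :: Y); split; last by rewrite !span_cons eY.
  by move=> y; rewrite !inE => /orP[->|/sYX ->]; rewrite ?orbT.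
by rewrite free_cons xY.
Qed.

Lemma trace_commutator n (X : n.-tuple V) u v :
    (forall i, u (tnth X i) \in <<X>>%VS) -> (forall i, v (tnth X i) \in <<X>>%VS) ->
  \sum_i coord X i (u (v (tnth X i))) = \sum_i coord X i (v (u (tnth X i))).
Proof.
move=> su sv.
have sE k x (w : 'End(V)) : x \in <<X>>%VS ->
    coord X k (w x) = \sum_j coord X j x * coord X k (w (tnth X j)).
  move=> xX; rewrite {1}(coord_span xX) !linear_sum /=.
  by apply: eq_bigr => j _; rewrite !linearZ (tnth_nth 0).
under eq_bigr do rewrite sE //.
under [RHS]eq_bigr do rewrite sE //.
rewrite exchange_big /=; apply: eq_bigr => i _.
by apply: eq_bigr => j _; rewrite mulrC.
Qed.

(** The tool behind all later trace arguments: when the commutator acts diagonally on a subspace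
    stable under u and v, its zero trace becomes a numerical relation between the eigenvalues. *)
Lemma trace_commutator_eigen (I : eqType) (r : seq I) (b : I -> V) (c : I -> F) u v :
    free (map b r) ->
    {in r, forall i, u (b i) \in <<map b r>>%VS} ->
    {in r, forall i, v (b i) \in <<map b r>>%VS} ->
    {in r, forall i, u (v (b i)) - v (u (b i)) = c i *: b i} ->
  \sum_(i <- r) c i = 0.
Proof.
case: r => [|i0 r']; first by rewrite big_nil.
move: (i0 :: r') => {r'}r fr su sv cE; pose X := in_tuple (map b r).
have szm : size (map b r) = size r by rewrite size_map.
have XE (k : 'I_(size (map b r))) : exists2 i, i \in r & tnth X k = b i.
  by have /mapP[i ir ->] := mem_tnth k X; exists i.
have su' k : u (tnth X k) \in <<X>>%VS by have [i ir ->] := XE k; apply: su.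
have sv' k : v (tnth X k) \in <<X>>%VS by have [i ir ->] := XE k; apply: sv.
rewrite (big_nth i0) big_mkord -szm.
rewrite -[RHS](subrr (\sum_k coord X k (u (v (tnth X k))))).
rewrite [X in _ = _ - X](trace_commutator su' sv') -sumrB; apply: eq_bigr => k _.
have kr : (k < size r)%N by rewrite -szm.
have -> : tnth X k = b (nth i0 r k) by rewrite (tnth_nth 0) /= (nth_map i0).
rewrite -linearB cE ?mem_nth // linearZ /=.
have -> : b (nth i0 r k) = X`_k by rewrite /= (nth_map i0).
by rewrite coord_free // eqxx mulr1.
Qed.

(** Applying u - c0 removes the component of eigenvalue c0 and multiplies every other one by the
    nonzero scalar c - c0, which allows induction on the number of eigenvalues. *)
Lemma stable_eigencomponent u W (cs : seq F) (Y : F -> V) :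
    {in W, forall x, u x \in W} -> uniq cs ->
    {in cs, forall c, u (Y c) = c *: Y c} ->
    \sum_(c <- cs) Y c \in W ->
  {in cs, forall c, Y c \in W}.
Proof.
move=> uW; elim: cs Y => [//|c0 cs IH] Y /= /andP[c0cs ucs] eY sW.
have eYcs : {in cs, forall c, u (Y c) = c *: Y c}.
  by move=> c cc; apply: eY; rewrite inE cc orbT.
have Ycs : {in cs, forall c, Y c \in W}.
  move=> c cc; have c0c : c - c0 != 0.
    by rewrite subr_eq0; apply: contraNneq c0cs => <-.
  rewrite -[Y c](scalerK c0c) memvZ //.
  have := IH (fun c => (c - c0) *: Y c) ucs; apply=> //.
    by move=> d dc; rewrite linearZ /= eYcs // scalerA mulrC -scalerA.
  have -> : \sum_(d <- cs) (d - c0) *: Y d =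
     u (\sum_(c <- c0 :: cs) Y c) - c0 *: (\sum_(c <- c0 :: cs) Y c).
    rewrite !big_cons linearD /= eY ?mem_head // linear_sum /= scalerDr opprD.
    rewrite addrACA subrr add0r scaler_sumr -sumrB.
    by rewrite big_seq [RHS]big_seq; apply: eq_bigr => d dc; rewrite eYcs // scalerBl.
  by rewrite memvB ?uW // memvZ.
move=> c; rewrite inE => /orP[/eqP->|/Ycs //].
move: sW; rewrite big_cons => sW.
rewrite -[Y c0](addrK (\sum_(j <- cs) Y j)) memvB //.
by rewrite big_seq; apply: memv_suml.
Qed.

Definition sum_of (P : V -> Prop) (x : V) : Prop :=
  exists2 s : seq V, {in s, forall y, P y} & x = \sum_(y <- s) y.

Lemma sum_of_trans (P Q : V -> Prop) x :
  (forall y, P y -> sum_of Q y) -> sum_of P x -> sum_of Q x.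
Proof.
move=> PQ [s sP ->]; elim: s sP => [|y s IH] sP.
  by exists [::]; rewrite ?big_nil.
have [s1 s1Q ->] := PQ y (sP y (mem_head _ _)).
case: IH => [z zs|s2 s2Q E]; first by apply: sP; rewrite inE zs orbT.
exists (s1 ++ s2); last by rewrite big_cons big_cat E.
by move=> z; rewrite mem_cat => /orP[/s1Q|/s2Q].
Qed.

(** A common eigenvector of the tail is split into its u-eigencomponents. By commutation the
    eigenspaces of the other operators are u-stable, so the components stay in them by
    [stable_eigencomponent]. *)
Lemma sum_of_common_eigenvectors (L : seq 'End(V)) :
    {in L &, forall u v, forall x, u (v x) = v (u x)} ->
    {in L, forall u x, sum_of (fun y => exists c, u y = c *: y) x} ->
  forall x, sum_of (fun y => {in L, forall u, exists c, u y = c *: y}) x.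
Proof.
elim: L => [_ _ x|u L IH comL dL x]; first by exists [:: x] => //; rewrite big_seq1.
have {}IH := IH _ _ x; case: IH => [||s sP xE].
- by move=> v w vL wL; apply: comL; rewrite inE ?vL ?wL orbT.
- by move=> v vL; apply: dL; rewrite inE vL orbT.
apply: (@sum_of_trans (fun y => {in L, forall u, exists c, u y = c *: y})); last by exists s.
move=> {sP xE s x} y yP; have [s sP yE] := dL u (mem_head _ _) y.
have [c cE] : exists c : V -> F, {in s, forall z, u z = c z *: z}.
  elim: s sP {yE} => [|z s IHs] sP; first by exists (fun=> 0).
  case: IHs => [w ws|c cE]; first by apply: sP; rewrite inE ws orbT.
  have [a aE] := sP z (mem_head _ _).
  exists (fun w => if w == z then a else c w) => w; rewrite inE.
  by case: eqP => [-> _|_ /= /cE].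
pose Y a := \sum_(z <- s | c z == a) z; pose cs := undup (map c s).
have uY a : u (Y a) = a *: Y a.
  rewrite linear_sum /= scaler_sumr big_seq_cond [RHS]big_seq_cond.
  by apply: eq_bigr => z /andP[/cE -> /eqP ->].
have ycs : y = \sum_(a <- cs) Y a.
  rewrite yE; under [RHS]eq_bigr do rewrite /Y big_mkcond.
  rewrite exchange_big /= big_seq [RHS]big_seq; apply: eq_bigr => z zs.
  have zcs : c z \in cs by rewrite mem_undup map_f.
  rewrite (bigD1_seq (c z)) ?undup_uniq //= eqxx big1 ?addr0 // => a /negPf.
  by rewrite eq_sym => ->.
exists [seq Y a | a <- cs]; last by rewrite big_map.
move=> _ /mapP[a acs ->] v; rewrite inE => /orP[/eqP->|vL]; first by exists a.
have [d dE] := yP v vL; exists d.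
have kerE x : (x \in passmx.leigenspace v d) = (v x == d *: x).
  by rewrite memv_ker add_lfunE opp_lfunE scale_lfunE id_lfunE subr_eq0.
apply/eqP; rewrite -kerE; apply: (@stable_eigencomponent u _ cs Y) acs => //.
- move=> z; rewrite !kerE => /eqP zE.
  by rewrite comL ?inE ?eqxx ?vL ?orbT // zE linearZ.
- exact: undup_uniq.
- by rewrite -ycs kerE dE.
Qed.

End LinearAlgebra.

(** * Weight bases *)

Section Representations.
Variables (F : fieldType) (g : lieAlgebra F) (t : {vspace g}).
Local Notation tdual := 'Hom(subvs_of t, F^o).
Local Notation adg := (adjoint_rep g).
Implicit Types (V : lieRep g) (mu alpha beta : tdual) (h : subvs_of t).

Lemma rep_act_br V x y v :
  rep_act V (lie_br x y) v = rep_act V x (rep_act V y v) - rep_act V y (rep_act V x v).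
Proof. by rewrite rep_br add_lfunE opp_lfunE !comp_lfunE. Qed.

Lemma weight_spaceE V mu v h :
  v \in weight_space V mu -> rep_act V (vsval h) v = (mu h : F) *: v.
Proof. by move/mem_weight_space. Qed.

Lemma rep_act_weight V mu alpha x v :
    x \in weight_space (t := t) adg alpha -> v \in weight_space V mu ->
  rep_act V x v \in weight_space V (mu + alpha).
Proof.
move=> /mem_weight_space xa /mem_weight_space vm; apply/mem_weight_space => h.
have := rep_act_br (vsval h) x v.
rewrite [lie_br _ _]xa vm linearZ /= scale_lfunE linearZ /= => /eqP.
by rewrite eq_sym subr_eq => /eqP ->; rewrite add_lfunE addrC scalerDl.
Qed.

Lemma weight_of_common_eigenvector V v :
    (forall i, exists c, rep_act V (vsval (tnth (tbasis t) i)) v = c *: v) ->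
  exists mu : tdual, v \in weight_space V mu.
Proof.
move=> /fin_all_exists[c cE].
pose f h : F^o := \sum_i coord (tbasis t) i h *: (c i : F^o).
have fl : linear f.
  move=> a x y; rewrite /f scaler_sumr -big_split; apply: eq_bigr => i _ /=.
  by rewrite linearP /= scalerDl scalerA.
pose f' : {linear subvs_of t -> F^o} := HB.pack f (GRing.isLinear.Build _ _ _ _ f fl).
exists (linfun f'); apply/mem_weight_space => h.
rewrite lfunE /= /f {1}(coord_vbasis (memvf h)) !linear_sum /= sum_lfunE scaler_suml.
apply: eq_bigr => i _; rewrite !linearZ /= scale_lfunE.
by rewrite -(tnth_nth 0 (tbasis t)) cE scalerA.
Qed.

(** With weights attached to basis indices, multiplicities are cardinals of fibres of [w], and sums
    over weights become sums over indices. *)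
Definition weight_basis V n (b : n.-tuple V) (w : 'I_n -> tdual) : Prop :=
  basis_of fullv b /\ forall i, tnth b i \in weight_space V (w i).

Lemma weight_basis_of_sum V :
    (forall x : V, sum_of (fun y => exists mu, y \in weight_space (t := t) V mu) x) ->
  exists n (b : n.-tuple V) w, weight_basis b w.
Proof.
move=> sumV.
have [X XP sX] : exists2 X : seq V,
    {in X, forall y, exists mu, y \in weight_space (t := t) V mu}
    & {subset (vbasis fullv : seq V) <= <<X>>%VS}.
  elim: (vbasis fullv : seq V) => [|x s [X XP sX]]; first by exists [::].
  have [Y YP ->] := sumV x; exists (Y ++ X).
    by move=> y; rewrite mem_cat => /orP[/YP|/XP].
  move=> y; rewrite inE span_cat => /orP[/eqP->|/sX yX].
    apply: (subvP (addvSl _ _)); rewrite big_seq; apply: memv_suml => z zY.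
    exact: memv_span.
  exact: (subvP (addvSr _ _)).
have [Y [sYX fY eY]] := free_subseq_span X.
have YP (i : 'I_(size Y)) : exists mu, tnth (in_tuple Y) i \in weight_space (t := t) V mu.
  by apply/XP/sYX; rewrite mem_tnth.
have [w wP] := fin_all_exists YP.
exists (size Y), (in_tuple Y), w; split=> //.
rewrite /basis_of fY andbT eY eqEsubv subvf /= -(span_basis (vbasisP fullv)).
by apply/span_subvP.
Qed.

Section WeightBasis.
Variables (V : lieRep g) (n : nat) (b : n.-tuple V) (w : 'I_n -> tdual).
Hypothesis bw : weight_basis b w.

Lemma weight_basis_free : free b. Proof. by case: bw => /basis_free. Qed.

Lemma weight_basis_sum v : v = \sum_i coord b i v *: tnth b i.
Proof.
case: bw => bV _; rewrite {1}(coord_basis bV (memvf v)).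
by apply: eq_bigr => i _; rewrite (tnth_nth 0).
Qed.

Lemma weight_basis_coord i j : coord b i (tnth b j) = (i == j)%:R.
Proof. by rewrite (tnth_nth 0) coord_free ?weight_basis_free // eq_sym. Qed.

Lemma weight_basis_weight i : tnth b i \in weight_space V (w i).
Proof. by case: bw. Qed.

Lemma coord_weight mu v i : v \in weight_space V mu -> coord b i v != 0 -> w i = mu.
Proof.
move=> /mem_weight_space vm vi; apply/lfunP => h; apply: (mulIf vi).
have := congr1 (coord b i) (vm h); rewrite linearZ /= => <-.
rewrite {2}(weight_basis_sum v) !linear_sum /= (bigD1 i) //= big1 => [|j ij].
  rewrite addr0 !linearZ /= (weight_spaceE _ (weight_basis_weight i)).
  by rewrite linearZ /= weight_basis_coord eqxx mulr1 mulrC.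
rewrite linearZ /= (weight_spaceE _ (weight_basis_weight j)).
by rewrite !linearZ /= weight_basis_coord eq_sym (negPf ij) !mulr0.
Qed.

Lemma weight_space_span mu v (r : seq 'I_n) :
    (forall i, w i = mu -> i \in r) -> v \in weight_space V mu ->
  v \in <<map (tnth b) r>>%VS.
Proof.
move=> rP vm; rewrite (weight_basis_sum v); apply: memv_suml => i _.
have [->|vi] := eqVneq (coord b i v) 0; first by rewrite scale0r mem0v.
by rewrite memvZ // memv_span // map_f // rP // (coord_weight vm vi).
Qed.

Lemma weight_basis_free_sub (r : seq 'I_n) : uniq r -> free (map (tnth b) r).
Proof.
move=> ur; apply: (@catl_free _ _ (map (tnth b) (filter [predC r] (enum 'I_n)))).
rewrite -map_cat (perm_free (Y := b)) ?weight_basis_free //.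
rewrite -[X in perm_eq _ X]map_tnth_enum perm_map // uniq_perm ?enum_uniq //.
  rewrite cat_uniq ur filter_uniq ?enum_uniq // andbT.
  by apply/hasPn => i; rewrite mem_filter => /andP[].
by move=> i; rewrite mem_cat mem_filter mem_enum inE /= andbT orbN.
Qed.

Lemma mult_weight_basis mu : mult V mu = #|[pred i | w i == mu]|.
Proof.
rewrite /mult; pose r := enum [pred i | w i == mu].
suff -> : weight_space V mu = <<map (tnth b) r>>%VS.
  by rewrite (eqP (weight_basis_free_sub (enum_uniq _))) size_map -cardE.
apply/eqP; rewrite eqEsubv; apply/andP; split.
  by apply/subvP => v; apply: weight_space_span => i wi; rewrite mem_enum inE wi.
apply/span_subvP => _ /mapP[i + ->]; rewrite mem_enum inE => /eqP <-.
exact: weight_basis_weight.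
Qed.

Lemma weight_basis_mult_gt0 mu : (0 < mult V mu)%N -> exists i, w i = mu.
Proof.
rewrite mult_weight_basis => mu0.
have [i /eqP wi|w0] := pickP [pred i | w i == mu]; first by exists i.
by rewrite eq_card0 in mu0.
Qed.

End WeightBasis.
End Representations.

(** * Root decomposition of a reductive Lie algebra *)

Section Reductive.
Variables (F : numFieldType) (g : lieAlgebra F) (t : {vspace g}).
Local Notation tdual := 'Hom(subvs_of t, F^o).
Local Notation adg := (adjoint_rep g).
Implicit Types (V : lieRep g) (mu alpha beta : tdual) (h : subvs_of t).

Lemma tdual_mulrz beta h (z : int) : (beta *~ z) h = (beta h : F) *~ z.
Proof. by rewrite -scaler_int scale_lfunE -[RHS]mulrzl. Qed.

Lemma tdual_mulrn beta h (k : nat) : (beta *+ k) h = (beta h : F) *+ k.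
Proof. by rewrite !pmulrn tdual_mulrz. Qed.

Lemma lie_brDl (x y z : g) : lie_br (x + y) z = lie_br x z + lie_br y z.
Proof. by rewrite /lie_br linearD add_lfunE. Qed.

Lemma lie_brDr (x y z : g) : lie_br x (y + z) = lie_br x y + lie_br x z.
Proof. by rewrite /lie_br linearD. Qed.

Lemma lie_brZl a (x y : g) : lie_br (a *: x) y = a *: lie_br x y.
Proof. by rewrite /lie_br linearZ scale_lfunE. Qed.

Lemma lie_brZr a (x y : g) : lie_br x (a *: y) = a *: lie_br x y.
Proof. by rewrite /lie_br linearZ. Qed.

Lemma lie_br0 (x : g) : lie_br x 0 = 0.
Proof. by rewrite /lie_br linear0. Qed.

Lemma lie_br_in_brv (U W : {vspace g}) x y :
  x \in U -> y \in W -> lie_br x y \in lie_brv U W.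
Proof.
move=> xU yW; rewrite (coord_vbasis xU) (coord_vbasis yW) /lie_br (linear_sum (lie_ad g)) /= sum_lfunE.
apply: memv_suml => i _; rewrite !linear_sum; apply: memv_suml => j _.
rewrite !linearZ /= scale_lfunE !memvZ //; apply/memv_span/allpairsP.
by exists ((vbasis U)`_i, (vbasis W)`_j); rewrite !mem_nth ?size_tuple.
Qed.

(** The line of z is an ideal, with complementary ideal J. Since z is central, every bracket already
    lies in J; hence z lies both in J and on its own line. *)
Lemma reductive_center_derived z :
    reductive g -> z \in lie_brv (fullv : {vspace g}) fullv ->
    (forall x : g, lie_br z x = 0) ->
  z = 0.
Proof.
move=> red zg zc; have zI : lie_ideal <[z]>%VS.
  by move=> x y /vlineP[k ->]; rewrite lie_brZr lie_brC zc oppr0 scaler0 mem0v.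
have [J [Jid IJ IJ0]] := red _ zI.
suff zJ : z \in J by apply/eqP; rewrite -memv0 -IJ0 memv_cap memv_line.
apply: (subvP _ _ zg); apply/span_subvP => _ /allpairsP[[x y] [_ _ ->]] /=.
have dec x' : exists k, exists2 j, j \in J & x' = k *: z + j.
  have : x' \in (<[z]> + J)%VS by rewrite IJ memvf.
  by case/memv_addP => _ /vlineP[k ->] [j jJ ->]; exists k, j.
have [k [j jJ ->]] := dec x; rewrite lie_brDl lie_brZl zc scaler0 add0r.
have [k' [j' jJ' ->]] := dec y; rewrite lie_brDr lie_brZr lie_brC zc oppr0 scaler0 add0r.
exact: Jid.
Qed.

(** An ideal complementary to [g, g] is abelian, since its brackets lie in both summands. It is
    therefore solvable, and semisimplicity makes it zero. *)
Lemma reductive_semisimple_perfect :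
  reductive g -> semisimple g -> lie_brv (fullv : {vspace g}) fullv = fullv.
Proof.
move=> red ss; set I := lie_brv _ _.
have Iid : lie_ideal I by move=> x y _; rewrite lie_br_in_brv ?memvf.
have [J [Jid IJ IJ0]] := red _ Iid.
suff J0 : J = 0%VS by rewrite -IJ J0 addv0.
apply: (ss _ Jid); exists 1%N => /=; apply/eqP; rewrite -subv0.
apply/span_subvP => _ /allpairsP[[x y] [/= _ yJ ->]].
rewrite -IJ0 memv_cap lie_br_in_brv ?memvf //.
by apply: Jid; apply: vbasis_mem.
Qed.

Hypothesis (red : reductive g) (car : cartan_subalgebra t).

Lemma weight_space0 x : (x \in weight_space (t := t) adg 0) = (x \in t).
Proof.
case: car => abel selfc _; apply/idP/idP => [x0|xt].
  apply: selfc => h ht; rewrite -(vsprojK ht) [LHS](weight_spaceE _ x0).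
  by rewrite zero_lfunE scale0r.
apply/mem_weight_space => h; rewrite zero_lfunE scale0r; apply: abel => //.
exact: subvsP.
Qed.

Lemma cartan_abelian h h' : lie_br (vsval h) (vsval h') = 0.
Proof. by case: car => abel _ _; apply: abel; apply: subvsP. Qed.

Lemma adjoint_weight_basis :
  exists n (b : n.-tuple adg) (w : 'I_n -> tdual), weight_basis b w.
Proof.
apply: weight_basis_of_sum => x.
pose L := [seq lie_ad g (vsval (tnth (tbasis t) i)) | i <- enum 'I_(rk t)].
have [u v /mapP[i _ ->] /mapP[j _ ->] y|u /mapP[i _ ->] y|s sP xE] :=
    @sum_of_common_eigenvectors _ _ L _ _ x.
- apply/eqP; rewrite -subr_eq0; apply/eqP.
  have := @rep_act_br _ _ adg (vsval (tnth (tbasis t) i)) (vsval (tnth (tbasis t) j)) y.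
  by rewrite cartan_abelian linear0 zero_lfunE => <-.
- case: car => _ _ /(_ _ (subvsP (tnth (tbasis t) i)))[e eb eP].
  exists [seq coord (in_tuple e) k y *: (in_tuple e)`_k | k <- enum 'I_(size e)].
    move=> _ /mapP[k _ ->]; have [c cE] := eP (in_tuple e)`_k (mem_nth _ (ltn_ord k)).
    by exists c; rewrite linearZ /= [lie_ad _ _ _]cE !scalerA mulrC.
  by rewrite big_map big_enum /=; apply: coord_basis (memvf y).
exists s => // y ys; apply: (@weight_of_common_eigenvector _ _ _ adg) => i.
by apply: (sP y ys); apply: map_f; rewrite mem_enum.
Qed.

(* [h] has trace zero on the sum of the weight spaces in [wV i + Z beta]. *)
Lemma weight_string_ratio V m (bV : m.-tuple V) (wV : 'I_m -> tdual) beta x y h i :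
    weight_basis bV wV ->
    x \in weight_space (t := t) adg beta -> y \in weight_space (t := t) adg (- beta) ->
    vsval h = lie_br x y ->
  exists N : nat, exists2 z : int, (0 < N)%N & (wV i h : F) *+ N = (beta h : F) *~ z.
Proof.
move=> bw xb yb hE.
pose P j := `[< exists z : int, wV j = wV i + beta *~ z >].
pose r := enum P.
have rP j : (j \in r) = P j by rewrite mem_enum.
have stab (e : g) gam (z : int) : gam = beta *~ z ->
    e \in weight_space (t := t) adg gam ->
    {in r, forall j, rep_act V e (tnth bV j) \in <<map (tnth bV) r>>%VS}.
  move=> -> eg j; rewrite rP => /asboolP[zj wj].
  apply: (weight_space_span bw _ (rep_act_weight eg (weight_basis_weight bw j))) => k wk.
  by rewrite rP; apply/asboolP; exists (zj + z); rewrite wk wj mulrzDr addrA.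
have zex j : exists z : int, P j -> wV j = wV i + beta *~ z.
  have [/asboolP[z zE]|nP] := boolP (P j).
    by exists z.
  by exists 0.
have [z zP] := fin_all_exists zex.
have s0 : \sum_(j <- r) (wV j h : F) = 0.
  apply: (@trace_commutator_eigen _ _ _ r (tnth bV) _ (rep_act V x) (rep_act V y)).
  - by apply: (weight_basis_free_sub bw); rewrite enum_uniq.
  - exact: (stab _ _ 1 _ xb).
  - exact: (stab _ _ (-1) _ yb).
  - by move=> j _; rewrite -rep_act_br -hE (weight_spaceE _ (weight_basis_weight bw j)).
(* The vanishing trace reads (size r) wV i (h) + (sum of the z j) beta(h) = 0; r is nonempty because
   it contains i. *)
exists (size r), (- \sum_(j <- r) z j).
  rewrite -has_predT; apply/hasP; exists i => //.
  by rewrite rP; apply/asboolP; exists 0; rewrite mulr0z addr0.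
rewrite mulrNz; apply/eqP; rewrite -addr_eq0; apply/eqP; rewrite -[RHS]s0.
rewrite mulrz_sumr -iter_addr_0 -(count_predT r) -big_const_seq -big_split /= big_seq [RHS]big_seq.
by apply: eq_bigr => j; rewrite rP => /zP ->; rewrite add_lfunE tdual_mulrz.
Qed.
End Reductive.

(** * The Killing form and the nonvanishing of brackets of opposite root vectors *)

Section RootSystem.
Variables (F : numFieldType) (g : lieAlgebra F) (t : {vspace g}).
Local Notation tdual := 'Hom(subvs_of t, F^o).
Local Notation adg := (adjoint_rep g).
Implicit Types (V : lieRep g) (mu alpha beta : tdual) (h : subvs_of t).
Hypothesis (red : reductive g) (car : cartan_subalgebra t).

(** For x in t, the component in J commutes with t, hence lies in t and vanishes; so t is contained
    in the complement J'. Then [t, J] lies in both ideals and is zero, and J is contained in the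
    centralizer t of t. *)
Lemma ideal_cap_cartan0 (J : {vspace g}) :
  lie_ideal J -> (J :&: t = 0)%VS -> J = 0%VS.
Proof.
move=> Jid Jt; have [J' [J'id JJ' JJ'0]] := red Jid.
have [abel selfc _] := car.
have inJJ' x : x \in J -> x \in J' -> x = 0.
  by move=> xJ xJ'; apply/eqP; rewrite -memv0 -JJ'0 memv_cap xJ xJ'.
have tJ' x : x \in t -> x \in J'.
  move=> xt; have : x \in (J + J')%VS by rewrite JJ' memvf.
  case/memv_addP => a aJ [b bJ' xab].
  suff -> : x = b by [].
  suff a0 : a = 0 by rewrite xab a0 add0r.
  have at_ : a \in t.
    apply: selfc => h ht; apply: inJJ'; first exact: Jid.
    have := abel _ _ ht xt; rewrite xab lie_brDr => /eqP.
    by rewrite addr_eq0 => /eqP ->; rewrite memvN; apply: J'id.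
  by apply/eqP; rewrite -memv0 -Jt memv_cap aJ.
apply/eqP; rewrite -subv0; apply/subvP => x xJ; rewrite -Jt memv_cap xJ.
apply: selfc => h ht; apply: inJJ'; first exact: Jid.
by rewrite lie_brC memvN; apply: J'id; apply: tJ'.
Qed.

Section AdjointBasis.
Variables (n : nat) (b : n.-tuple adg) (w : 'I_n -> tdual).
Hypothesis bw : weight_basis b w.

Let tr (u : 'End(g)) : F := \sum_i coord b i (u (tnth b i)).

Let trD u v : tr (u + v) = tr u + tr v.
Proof. by rewrite -big_split; apply: eq_bigr => i _; rewrite add_lfunE linearD. Qed.

Let trN u : tr (- u) = - tr u.
Proof. by rewrite -sumrN; apply: eq_bigr => i _; rewrite opp_lfunE linearN. Qed.

Let trZ a u : tr (a *: u) = a * tr u.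
Proof. by rewrite mulr_sumr; apply: eq_bigr => i _; rewrite scale_lfunE linearZ. Qed.

Let trC u v : tr (u \o v)%VF = tr (v \o u)%VF.
Proof.
have bE x : x \in <<b>>%VS by case: bw => /span_basis -> _; rewrite memvf.
rewrite /tr; under eq_bigr do rewrite comp_lfunE.
by rewrite (@trace_commutator _ adg) //; apply: eq_bigr => i _; rewrite comp_lfunE.
Qed.

Definition killing (x y : g) : F := tr (lie_ad g x \o lie_ad g y)%VF.

Lemma killingDl x y z : killing (x + y) z = killing x z + killing y z.
Proof. by rewrite /killing linearD comp_lfunDl trD. Qed.

Lemma killingZl a x z : killing (a *: x) z = a * killing x z.
Proof. by rewrite /killing linearZ -comp_lfunZl trZ. Qed.

Lemma killingC x y : killing x y = killing y x.
Proof. exact: trC. Qed.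

Lemma killing_invariant x y z : killing (lie_br x y) z = killing x (lie_br y z).
Proof.
rewrite /killing !lie_ad_br comp_lfunDl comp_lfunNl comp_lfunDr comp_lfunNr.
by rewrite !trD !trN -!comp_lfunA [X in _ - X]trC -comp_lfunA.
Qed.

Lemma killing_lin_is_linear y : linear (killing^~ y : g -> F^o).
Proof. by move=> a x z /=; rewrite killingDl killingZl. Qed.

Lemma killing_cartan h h' :
  killing (vsval h) (vsval h') = \sum_i (w i h : F) * (w i h' : F).
Proof.
apply: eq_bigr => i _; rewrite comp_lfunE.
have bi := weight_basis_weight bw i.
rewrite [lie_ad _ (vsval h') _](weight_spaceE _ bi) linearZ /=.
rewrite [lie_ad _ (vsval h) _](weight_spaceE _ bi) !linearZ /= (weight_basis_coord bw).
by rewrite eqxx mulr1 mulrC.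
Qed.

Lemma killing_weight alpha beta x y :
    x \in weight_space (t := t) adg alpha -> y \in weight_space (t := t) adg beta ->
  killing x y != 0 -> alpha = - beta.
Proof.
move=> xa yb kxy; apply/lfunP => h; apply: (mulIf kxy); rewrite opp_lfunE mulNr.
have hx : lie_br (vsval h) x = (alpha h : F) *: x by exact: (weight_spaceE h xa).
have hy : lie_br (vsval h) y = (beta h : F) *: y by exact: (weight_spaceE h yb).
rewrite -killingZl -hx lie_brC -scaleN1r killingZl killing_invariant hy mulN1r.
by rewrite killingC killingZl killingC.
Qed.

Lemma killing_sumr x y : killing x y = \sum_i coord b i y * killing x (tnth b i).
Proof.
rewrite killingC {1}(weight_basis_sum bw y).
pose f : {linear g -> F^o} :=
  HB.pack (killing^~ x : g -> F^o) (GRing.isLinear.Build _ _ _ _ _ (@killing_lin_is_linear x)).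
rewrite -[LHS]/(f _) linear_sum; apply: eq_bigr => i _.
by rewrite linearZ /= killingC.
Qed.

(** The factor is the rational z / N. That it is real makes the sum of squares in the next lemma
    definite. *)
Lemma root_bracket_ratio beta x y h i :
    x \in weight_space (t := t) adg beta -> y \in weight_space (t := t) adg (- beta) ->
    vsval h = lie_br x y ->
  exists2 q : F, q \is Num.real & (w i h : F) = q * (beta h : F).
Proof.
move=> xb yb hE; have [N [z N0 E]] := weight_string_ratio i bw xb yb hE.
have N0' : N%:R != 0 :> F by rewrite pnatr_eq0 -lt0n.
exists (z%:~R / N%:R).
  by rewrite realM // ?realV ?realn // realz.
by apply: (mulIf N0'); rewrite mulr_natr E mulrAC divfK // -[LHS]mulrzl.
Qed.

(** If beta(h) were nonzero, dividing K(h, h) = 0 by beta(h)^2 would give a vanishing sum of real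
    squares, one of them equal to 1 because beta is some w k. So beta(h) = 0, and then every w i
    vanishes at h; thus h is central and a bracket, hence zero. *)
Lemma root_bracket_isotropic beta x y h :
    beta \in map w (enum 'I_n) ->
    x \in weight_space (t := t) adg beta -> y \in weight_space (t := t) adg (- beta) ->
    vsval h = lie_br x y -> (beta h : F) = 0 \/ killing (vsval h) (vsval h) = 0 ->
  vsval h = 0.
Proof.
move=> /mapP[k _ bk] xb yb hE cond.
have wr i := root_bracket_ratio i xb yb hE.
have bh0 : (beta h : F) = 0.
  case: cond => // K0; apply/eqP; apply: contraTT isT => bh.
  have : \sum_i (w i h / beta h) ^+ 2 == 0 :> F.
    have : (beta h : F) ^+ 2 * \sum_i (w i h / beta h) ^+ 2 = 0.
      rewrite mulr_sumr -[RHS]K0 killing_cartan; apply: eq_bigr => i _.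
      by rewrite -exprMn mulrC divfK.
    by move/eqP; rewrite mulf_eq0 expf_eq0 (negPf bh).
  rewrite psumr_eq0 => [/allP /(_ k)|i _].
    by rewrite mem_index_enum -bk divff // expr1n oner_eq0 => /(_ isT).
  by have [q qr ->] := wr i; rewrite mulfK // real_exprn_even_ge0.
apply: (reductive_center_derived red); first by rewrite hE lie_br_in_brv ?memvf.
move=> x'; rewrite (weight_basis_sum bw x') /lie_br linear_sum big1 // => i _.
rewrite linearZ /= [lie_ad _ _ _](weight_spaceE _ (weight_basis_weight bw i)).
by have [q _ ->] := wr i; rewrite bh0 mulr0 scale0r scaler0.
Qed.

Lemma weight_span_cap (P : pred 'I_n) v :
  reflect (forall i, ~~ P i -> coord b i v = 0)
          (v \in <<[seq tnth b i | i <- enum P]>>%VS).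
Proof.
apply: (iffP idP) => [vP i Pi|vP].
  rewrite (coord_span (X := in_tuple _) vP) linear_sum big1 //= => j _.
  have : (in_tuple [seq tnth b i | i <- enum P])`_j \in [seq tnth b i | i <- enum P].
    exact: mem_nth.
  rewrite linearZ /= => /mapP[k + ->]; rewrite mem_enum => Pk.
  rewrite (weight_basis_coord bw).
  case: eqP => [ik|_]; rewrite ?mulr0 //.
  by move: Pi; rewrite ik -topredE /= in Pk *; rewrite Pk.
rewrite (weight_basis_sum bw v); apply: memv_suml => i _.
have [Pi|/vP ->] := boolP (P i); last by rewrite scale0r mem0v.
by rewrite memvZ // memv_span // map_f // mem_enum.
Qed.

(* If [x, y] = 0 for all y in g_(-alpha), then x lies in the radical of the
   Killing form; the elements of the radical without component in t form an
   ideal, which must vanish by [ideal_cap_cartan0]. *)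
Lemma root_bracket_neq0 alpha x :
    alpha != 0 -> x \in weight_space (t := t) adg alpha -> x != 0 ->
  exists2 y, y \in weight_space (t := t) adg (- alpha) &
    exists2 h : subvs_of t, vsval h = lie_br x y & (alpha h : F) != 0.
Proof.
move=> a0 xa x0; apply: contrapT => nex.
have aw : alpha \in map w (enum 'I_n).
  have : [exists i, coord b i x != 0].
    apply: contraNT x0 => /existsPn nx.
    rewrite (weight_basis_sum bw x) big1 // => i _.
    by have := nx i; rewrite negbK => /eqP ->; rewrite scale0r.
  case/existsP => i xi; apply/mapP; exists i; rewrite ?mem_enum //.
  by rewrite (coord_weight bw xa xi).
have brt beta y z : y \in weight_space (t := t) adg beta ->
    z \in weight_space (t := t) adg (- beta) ->
    exists h : subvs_of t, vsval h = lie_br y z.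
  move=> yb zb; exists (vsproj t (lie_br y z)); rewrite vsprojK //.
  by rewrite -(weight_space0 car) -(addNr beta); apply: (rep_act_weight (V := adg)).
have xy0 y : y \in weight_space (t := t) adg (- alpha) -> lie_br x y = 0.
  move=> ya; have [h hE] := brt _ _ _ xa ya.
  rewrite -hE; apply: (root_bracket_isotropic aw xa ya hE); left.
  apply: contrapT => /eqP ah; apply: nex; exists y => //; exists h => //.
have xrad y : killing x y = 0.
  rewrite killing_sumr big1 // => i _; apply/eqP; rewrite mulf_eq0 orbC.
  apply: contraTT isT; rewrite negb_or => /andP[kx _].
  have bi := weight_basis_weight bw i.
  have wi : - alpha = w i by rewrite (killing_weight xa bi kx) opprK.
  have [h ah] : exists h, (alpha h : F) != 0.
    apply: contrapT => nh; move/eqP: a0; apply; apply/lfunP => h.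
    by rewrite zero_lfunE; apply: contrapT => /eqP ah; apply: nh; exists h.
  have hx : lie_br (vsval h) x = (alpha h : F) *: x by exact: (weight_spaceE h xa).
  move: kx; rewrite -(mulrI_eq0 _ (lregP ah)) -killingZl -hx killing_invariant.
  rewrite xy0; last by rewrite wi.
  by rewrite killingC -[X in killing X](scale0r (0 : g)) killingZl mul0r eqxx.
pose radf (z : g) := \row_(i < n) killing z (tnth b i).
have radl : linear radf.
  by move=> a y z; apply/rowP => i; rewrite !mxE killingDl killingZl.
pose radf' : {linear g -> 'rV[F]_n} := HB.pack radf (GRing.isLinear.Build _ _ _ _ _ radl).
have radP z : reflect (forall y, killing z y = 0) (z \in lker (linfun radf')).
  rewrite memv_ker lfunE /=; apply: (iffP eqP) => [z0 y|z0].
    rewrite killing_sumr big1 // => i _.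
    by have /rowP/(_ i) := z0; rewrite !mxE => ->; rewrite mulr0.
  by apply/rowP => i; rewrite !mxE z0.
pose P : pred 'I_n := fun i => w i != 0.
pose J := (lker (linfun radf') :&: <<[seq tnth b i | i <- enum P]>>)%VS.
have J0 : J = 0%VS.
  apply: ideal_cap_cartan0; last first.
    apply/eqP; rewrite -subv0; apply/subvP => z; rewrite 2!memv_cap memv0.
    case/andP => /andP[_ /weight_span_cap zP]; rewrite -(weight_space0 car) => z0.
    apply/eqP; rewrite (weight_basis_sum bw z) big1 // => i _.
    have [->|zi] := eqVneq (coord b i z) 0; first by rewrite scale0r.
    by rewrite zP ?scale0r // /P (coord_weight bw z0 zi) eqxx.
  move=> z y; rewrite !memv_cap => /andP[/radP yrad /weight_span_cap yP].
  apply/andP; split.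
    by apply/radP => z'; rewrite lie_brC -scaleN1r killingZl killing_invariant yrad mulr0.
  rewrite (weight_basis_sum bw z) /lie_br linear_sum sum_lfunE.
  apply: memv_suml => k _; rewrite linearZ scale_lfunE memvZ //.
  (* Only [y'], the component of y of weight - w k, can contribute to the t-part of [b_k, y]. The
     Killing form pairs opposite weights only, so [y'] is again in the radical; [b_k, y'] is then
     isotropic, hence zero. *)
  pose y' := \sum_(j | w j == - w k) coord b j y *: tnth b j.
  have y'w : y' \in weight_space (t := t) adg (- w k).
    apply: memv_suml => j /eqP <-; rewrite memvZ //; exact: (weight_basis_weight bw).
  have bk := weight_basis_weight bw k.
  have y'rad z' : killing z' y' = 0.
    rewrite killingC killing_sumr big1 // => i _.
    have [/eqP wi|wi] := boolP (w i == w k); last first.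
      apply/eqP; rewrite mulf_eq0 orbC; apply: contraNT wi; rewrite negb_or.
      case/andP => /(killing_weight y'w (weight_basis_weight bw i)) + _.
      by move/oppr_inj => ->.
    suff -> : killing y' (tnth b i) = killing y (tnth b i) by rewrite yrad mulr0.
    rewrite killingC [RHS]killingC [RHS]killing_sumr [LHS]killing_sumr.
    apply: eq_bigr => j _.
    have [wj|wj] := boolP (w j == - w k).
      congr (_ * _); rewrite linear_sum (bigD1 j) //= big1 => [|l /andP[_ lj]].
        by rewrite linearZ /= (weight_basis_coord bw) eqxx mulr1 addr0.
      by rewrite linearZ /= (weight_basis_coord bw) eq_sym (negPf lj) mulr0.
    have [->|kij] := eqVneq (killing (tnth b i) (tnth b j)) 0; first by rewrite !mulr0.
    move: wj; rewrite -wi (killing_weight (weight_basis_weight bw i) (weight_basis_weight bw j) kij).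
    by rewrite opprK eqxx.
  have [h hE] := brt _ _ _ bk y'w.
  have kw : w k \in map w (enum 'I_n) by rewrite map_f ?mem_enum.
  have by'0 : lie_br (tnth b k) y' = 0.
    rewrite -hE; apply: (root_bracket_isotropic kw bk y'w hE); right.
    by rewrite hE -killing_invariant y'rad.
  apply/weight_span_cap => i; rewrite /P negbK => /eqP wi0.
  have -> : lie_ad g (tnth b k) y = lie_br (tnth b k) (y - y').
    by rewrite lie_brDr -scaleN1r lie_brZr by'0 scaler0 addr0.
  have -> : y - y' = \sum_(j | w j != - w k) coord b j y *: tnth b j.
    by rewrite {1}(weight_basis_sum bw y) (bigID (fun j => w j == - w k)) /= addrAC subrr add0r.
  rewrite /lie_br !linear_sum big1 // => j wj; rewrite !linearZ /=.
  apply/eqP; rewrite mulf_eq0 orbC; apply: contraNT wj; rewrite negb_or => /andP[cij _].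
  have := coord_weight bw (rep_act_weight bk (weight_basis_weight bw j)) cij.
  by rewrite wi0 => /esym/eqP; rewrite addr_eq0.
have : x \in J.
  rewrite memv_cap; apply/andP; split; first by apply/radP.
  apply/weight_span_cap => i; rewrite /P negbK => /eqP wi0.
  by apply: contra_neq_eq a0 => xi; rewrite -(coord_weight bw xa xi).
by rewrite J0 memv0 (negPf x0).
Qed.

End AdjointBasis.
End RootSystem.

(** * Weight strings of sl2-triples *)

Section SL2.
Variables (F : numFieldType) (g : lieAlgebra F) (t : {vspace g}).
Local Notation tdual := 'Hom(subvs_of t, F^o).
Local Notation adg := (adjoint_rep g).
Implicit Types (V : lieRep g) (mu alpha beta : tdual) (h : subvs_of t).

Lemma rep_act_iter_weight V mu alpha x v k :
    x \in weight_space (t := t) adg alpha -> v \in weight_space V mu ->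
  iter k (rep_act V x) v \in weight_space V (mu + alpha *+ k).
Proof.
move=> xa vm; elim: k => [|k IH]; first by rewrite addr0.
by rewrite mulrSr addrA /=; apply: rep_act_weight.
Qed.

Lemma tdual_mulrn_inj alpha (i j : nat) : alpha != 0 -> alpha *+ i = alpha *+ j -> i = j.
Proof.
move=> a0 E; apply/eqP; apply: contra_neqT a0 => ij; apply/lfunP => h.
have /eqP := congr1 (fun f : tdual => f h : F) E; rewrite !tdual_mulrn zero_lfunE.
rewrite -subr_eq0 -mulr_natr -[X in _ - X]mulr_natr -mulrBr mulf_eq0 subr_eq0 eqr_nat.
by rewrite (negPf ij) orbF => /eqP.
Qed.

Lemma rep_act_iter_nilpotent V n (b : n.-tuple V) (w : 'I_n -> tdual) mu alpha x v :
    weight_basis b w -> alpha != 0 ->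
    x \in weight_space (t := t) adg alpha -> v \in weight_space V mu ->
  exists k, iter k (rep_act V x) v = 0.
Proof.
move=> bw a0 xa vm; apply: contrapT => nk.
(* If no power killed v, there would be n + 1 distinct weights among the n weights of the basis. *)
have ex (k : 'I_n.+1) : exists i, w i = mu + alpha *+ k.
  apply: (weight_basis_mult_gt0 bw); rewrite /mult lt0n dimv_eq0.
  apply: contra_notN nk => /eqP w0; exists k; apply/eqP; rewrite -memv0 -w0.
  exact: rep_act_iter_weight.
have [i iP] := fin_all_exists ex.
have /leq_card : injective i.
  move=> k l E; apply/val_inj/(tdual_mulrn_inj a0)/(addrI mu).
  by rewrite -iP E iP.
by rewrite !card_ord ltnn.
Qed.

Lemma weight_vectors_free V n (b : n.-tuple V) (w : 'I_n -> tdual)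
    (I : eqType) (r : seq I) (c : I -> V) (nu : I -> tdual) :
    weight_basis b w -> uniq r -> {in r &, injective nu} ->
    {in r, forall i, c i \in weight_space V (nu i)} -> {in r, forall i, c i != 0} ->
  free (map c r).
Proof.
move=> bw; elim: r => [|i r IH] /= => [_ _ _ _|/andP[ir ur] inj wc c0].
  exact: nil_free.
rewrite free_cons IH //; first last.
- by move=> j jr; apply: c0; rewrite inE jr orbT.
- by move=> j jr; apply: wc; rewrite inE jr orbT.
- by move=> j k jr kr; apply: inj; rewrite inE ?jr ?kr orbT.
rewrite andbT; apply/negP => ci.
have /negP := c0 i (mem_head _ _); apply; apply/eqP.
rewrite (weight_basis_sum bw (c i)) big1 // => k _; apply/eqP.
rewrite scaler_eq0; apply/orP; left; apply: contraTT isT => cik.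
have wk := coord_weight bw (wc i (mem_head _ _)) cik.
move/negP: cik; case.
rewrite (coord_span (X := in_tuple _) ci) linear_sum big1 //= => j _.
have : (in_tuple (map c r))`_j \in map c r by apply: mem_nth.
rewrite linearZ /= => /mapP[l lr ->].
apply/eqP; rewrite mulf_eq0 orbC; apply/orP; left; apply: contraNT ir => clk.
have wl : l \in i :: r by rewrite inE lr orbT.
have := coord_weight bw (wc l wl) clk; rewrite wk => /(inj _ _ (mem_head _ _) wl).
by move=> ->.
Qed.

(** The last nonzero u = f^a v is killed by f, so u, e u, ..., e^r u span a subspace stable under e
    and f. There h has eigenvalues l + 2 i with l = mu(h) - 2 a, and zero trace gives (r + 1)(l + r)
    = 0. *)
Lemma sl2_weight_string V n (b : n.-tuple V) (w : 'I_n -> tdual) beta e f h mu v :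
    weight_basis b w -> e \in weight_space (t := t) adg beta ->
    f \in weight_space (t := t) adg (- beta) ->
    vsval h = lie_br e f -> (beta h : F) = 2%:R ->
    v \in weight_space V mu -> v != 0 ->
  exists a r : nat, [/\ iter a.+1 (rep_act V f) v = 0, iter a (rep_act V f) v != 0,
    iter r (rep_act V e) (iter a (rep_act V f) v) != 0 & (mu h : F) + r%:R = a%:R *+ 2].
Proof.
move=> bw eb fb hE bh vm v0.
have b0 : beta != 0 by apply: contraTneq isT => b0; move/eqP: bh; rewrite b0 zero_lfunE eq_sym pnatr_eq0.
have last_iter alpha (nu : tdual) x u : alpha != 0 -> x \in weight_space (t := t) adg alpha ->
    u \in weight_space V nu -> u != 0 ->
    exists2 k, iter k.+1 (rep_act V x) u = 0 & iter k (rep_act V x) u != 0.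
  move=> a0 xa un u0.
  have ex : exists k, iter k (rep_act V x) u == 0.
    by have [k kE] := rep_act_iter_nilpotent bw a0 xa un; exists k; apply/eqP.
  case: (ex_minnP ex) => [[|k]] /eqP k0 kmin; first by move: u0; rewrite -k0 eqxx.
  by exists k => //; apply/negP => k1; have := kmin _ k1; rewrite ltnn.
have nb0 : - beta != 0 by rewrite oppr_eq0.
have [a a1 an0] := last_iter _ _ _ _ nb0 fb vm v0.
exists a; set u := iter a _ v in an0 *.
have uw : u \in weight_space V (mu + (- beta) *+ a) by apply: rep_act_iter_weight.
have [r r1 rn0] := last_iter _ _ _ _ b0 eb uw an0.
exists r; split=> //.
pose c i := iter i (rep_act V e) u.
pose l : F := (mu h : F) - 2%:R * a%:R.
have cw i : c i \in weight_space V (mu + (- beta) *+ a + beta *+ i).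
  exact: rep_act_iter_weight.
have hc i : rep_act V (vsval h) (c i) = (l + 2%:R * i%:R) *: c i.
  rewrite (weight_spaceE _ (cw i)) !add_lfunE !tdual_mulrn opp_lfunE bh mulNrn.
  by rewrite /l !mulr_natr.
have fc0 : rep_act V f (c 0) = 0 by [].
(* The trace argument needs only stability of the span, so the coefficient is left unspecified. *)
have fcS i : exists k, rep_act V f (c i.+1) = k *: c i.
  have E j : rep_act V f (c j.+1) = rep_act V e (rep_act V f (c j)) - (l + 2%:R * j%:R) *: c j.
    by rewrite -hc hE rep_act_br opprB addrC subrK.
  elim: i => [|i [k kE]].
    by exists (- (l + 2%:R * 0%:R)); rewrite E fc0 linear0 add0r scaleNr.
  by exists (k - (l + 2%:R * i.+1%:R)); rewrite E kE linearZ scalerBl.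
have cn0 i : (i <= r)%N -> c i != 0.
  move=> ir; apply: contra_neqN rn0 => /eqP ci.
  by rewrite -(subnK ir) iterD -/(c i) ci; elim: (r - i)%N => [|k IH] //=; rewrite IH linear0.
have fr : free (map c (iota 0 r.+1)).
  apply: (weight_vectors_free (nu := fun i => mu + (- beta) *+ a + beta *+ i) bw).
  - exact: iota_uniq.
  - by move=> i j _ _ /addrI/(tdual_mulrn_inj b0).
  - by move=> i _.
  - by move=> i; rewrite mem_iota => /cn0.
have memc i : (i <= r)%N -> c i \in <<map c (iota 0 r.+1)>>%VS.
  by move=> ir; apply/memv_span/map_f; rewrite mem_iota.
have s0 : \sum_(i <- iota 0 r.+1) (l + 2%:R * i%:R) = 0.
  apply: (trace_commutator_eigen (u := rep_act V e) (v := rep_act V f) fr).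
  - move=> i; rewrite mem_iota /= add0n ltnS leq_eqVlt => /orP[/eqP->|ir].
      by rewrite [rep_act _ _ _]r1 mem0v.
    exact: (memc i.+1).
  - move=> [_|i]; first by rewrite fc0 mem0v.
    rewrite mem_iota => ir; have [k ->] := fcS i; rewrite memvZ // memc //.
    exact: ltnW.
  - by move=> i _; rewrite -rep_act_br -hE hc.
have gauss k : 2%:R * (\sum_(0 <= i < k.+1) i%:R) = k.+1%:R * k%:R :> F.
  elim: k => [|k IH]; first by rewrite big_nat1 !mulr0.
  by rewrite big_nat_recr //= mulrDr IH -!natrM -natrD; congr (_%:R); lia.
have : (r.+1%:R : F) * (l + r%:R) = 0.
  rewrite -s0 -[iota 0 r.+1]/(index_iota 0 r.+1) big_split -mulr_sumr gauss.
  by rewrite sumr_const_nat subn0 mulrDr mulr_natl.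
move/eqP; rewrite mulf_eq0 pnatr_eq0 /= /l => /eqP E.
by apply/eqP; rewrite -subr_eq0 -E -mulr_natr mulrC; apply/eqP; ring.
Qed.
End SL2.

(** * Root spaces and coroots *)

Section Roots.
Variables (F : numFieldType) (g : lieAlgebra F) (t : {vspace g}).
Local Notation tdual := 'Hom(subvs_of t, F^o).
Local Notation adg := (adjoint_rep g).
Local Notation root := Defs.root.
Implicit Types (V : lieRep g) (mu alpha beta : tdual) (h : subvs_of t).
Hypothesis (red : reductive g) (car : cartan_subalgebra t).

Lemma root_sl2 alpha x :
    alpha != 0 -> x \in weight_space (t := t) adg alpha -> x != 0 ->
  exists2 y, y \in weight_space (t := t) adg (- alpha) &
    exists2 h : subvs_of t, vsval h = lie_br x y & (alpha h : F) = 2%:R.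
Proof.
move=> a0 xa x0; have [n [b [w bw]]] := adjoint_weight_basis car.
have [y ya [h hE ah]] := root_bracket_neq0 red car bw a0 xa x0.
exists ((2%:R / alpha h) *: y); first by rewrite memvZ.
exists ((2%:R / alpha h) *: h); first by rewrite lie_brZr -hE linearZ.
by rewrite linearZ /= -[LHS]/(2%:R / alpha h * alpha h) divfK.
Qed.

Lemma root_vector alpha : root alpha ->
  exists2 x, x \in weight_space (t := t) adg alpha & x != 0.
Proof.
case=> _; rewrite /mult lt0n dimv_eq0 => a0.
by exists (vpick (weight_space (t := t) adg alpha)); rewrite ?memv_pick ?vpick0.
Qed.

Lemma root_of_weight_vector alpha x :
  alpha != 0 -> x \in weight_space (t := t) adg alpha -> x != 0 -> root alpha.
Proof.
move=> /eqP a0 xa x0; split=> //; rewrite /mult lt0n dimv_eq0.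
by apply: contraNneq x0 => E; rewrite E memv0 in xa.
Qed.

Lemma rootN alpha : root alpha -> root (- alpha).
Proof.
move=> ra; have [x xa x0] := root_vector ra; have a0 : alpha != 0 by case: ra => /eqP.
have [y ya [h hE ah]] := root_sl2 a0 xa x0.
apply: (root_of_weight_vector _ ya); first by rewrite oppr_eq0.
apply: contra_eq_neq ah => y0; have h0 : h = 0 by apply/val_inj; rewrite /= hE y0 lie_br0.
by rewrite h0 linear0 eq_sym pnatr_eq0.
Qed.

(* [h] has trace zero on F f + t + \sum_(m >= 1) g_(m alpha). *)
Lemma mult_root alpha : alpha != 0 -> (mult adg alpha <= 1)%N.
Proof.
move=> a0; have [n [b [w bw]]] := adjoint_weight_basis car.
rewrite (mult_weight_basis bw); apply/card_le1_eqP => i j.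
rewrite !inE => /eqP wi /eqP wj; apply: contrapT => /eqP ij.
set e := tnth b i; have ea : e \in weight_space (t := t) adg alpha.
  by rewrite -wi; apply: (weight_basis_weight bw).
have e0 : e != 0.
  apply: contraTneq isT => e0; have /eqP := weight_basis_coord bw i i.
  by rewrite -/e e0 linear0 eqxx eq_sym oner_eq0.
have [f fa [h hE ah]] := root_sl2 a0 ea e0.
have h0 : f != 0.
  apply: contra_eq_neq ah => y0; have h0 : h = 0 by apply/val_inj; rewrite /= hE y0 lie_br0.
  by rewrite h0 linear0 eq_sym pnatr_eq0.
(* [Some k] runs over the basis vectors whose weight is a natural multiple of alpha, the multiple 0
   giving those in t; [None] stands for f. *)
pose P k := `[< exists m : nat, w k = alpha *+ m >].
pose r := map Some (enum P).
pose c o := if o is Some k then tnth b k else f.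
pose eig o : F := if o is Some k then w k h : F else - 2%:R.
have mr k : (Some k \in r) = P k by rewrite mem_map ?mem_enum // => ? ? [].
have bwk k : tnth b k \in weight_space (t := t) adg (w k) by apply: (weight_basis_weight bw).
have mapr : map c r = map (tnth b) (enum P) by rewrite -map_comp.
have memP v m : v \in weight_space (t := t) adg (alpha *+ m) -> v \in <<map c (None :: r)>>%VS.
  move=> va; rewrite /= mapr span_cons; apply: (subvP (addvSr _ _)).
  by apply: (weight_space_span bw _ va) => k wk; rewrite mem_enum; apply/asboolP; exists m.
have nalpha m : - alpha <> alpha *+ m.
  move=> E; have : alpha *+ m.+1 = alpha *+ 0 by rewrite mulrS -E subrr.
  by move/(tdual_mulrn_inj a0).
have s0 : \sum_(o <- None :: r) eig o = 0.
  apply: (trace_commutator_eigen (b := c) (u := lie_ad g e) (v := lie_ad g f)).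
  - rewrite /= mapr free_cons (weight_basis_free_sub bw (enum_uniq _)) andbT.
    apply/negP => /(weight_span_cap bw) fP; move/negP: h0; apply.
    rewrite (weight_basis_sum bw f) big1 // => k _; apply/eqP.
    rewrite scaler_eq0; apply/orP; left; apply: contraTT isT => fk.
    have wk := coord_weight bw fa fk; move/eqP: fk; case; apply: fP.
    by apply/asboolP => -[m]; rewrite wk; apply: nalpha.
  - move=> [k|] kr; last first.
      apply: (memP _ 0%N); rewrite mulr0n -(addNr alpha).
      exact: (rep_act_weight (V := adg) ea fa).
    move: kr; rewrite inE /= mr => /asboolP[m wk]; apply: (memP _ m.+1).
    by rewrite mulrSr -wk; apply: (rep_act_weight (V := adg)).
  - move=> [k|] kr; last by rewrite [lie_ad _ _ _]lie_alt mem0v.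
    move: kr; rewrite inE /= mr => /asboolP[[|m] wk].
      have kt : tnth b k \in t by rewrite -(weight_space0 car) -[0](mulr0n alpha) -wk.
      have -> : lie_ad g f (tnth b k) = (alpha (vsproj t (tnth b k)) : F) *: f.
        rewrite [LHS]lie_brC -{1}(vsprojK kt) [lie_br _ _](weight_spaceE _ fa).
        by rewrite opp_lfunE scaleNr opprK.
      by rewrite memvZ // memv_span // mem_head.
    apply: (memP _ m); suff -> : alpha *+ m = w k - alpha.
      exact: (rep_act_weight (V := adg)).
    by rewrite wk mulrSr addrK.
  - move=> o oP; have := rep_act_br (V := adg) e f (c o); rewrite -hE => <-.
    case: o {oP} => [k|] /=; first exact: (weight_spaceE h (bwk k)).
    by rewrite (weight_spaceE (V := adg) h fa) opp_lfunE ah.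
have memr k : w k = alpha -> k \in enum P.
  by move=> wk; rewrite mem_enum; apply/asboolP; exists 1%N.
(* The trace is - 2 from f plus 2 m for each index of weight m alpha. The two indices i and j of
   weight alpha make it at least 2, a contradiction. *)
move: s0; rewrite big_cons big_map (bigD1_seq i) ?memr ?enum_uniq //=.
have uf : uniq [seq k <- enum P | k != i] by apply/filter_uniq/enum_uniq.
have jf : j \in [seq k <- enum P | k != i] by rewrite mem_filter ij memr.
rewrite -big_filter (bigD1_seq j jf uf) /=.
rewrite wi wj ah.
rewrite addKr => /eqP; rewrite paddr_eq0 ?ler0n //.
  by rewrite pnatr_eq0.
rewrite big_filter_cond big_seq_cond; apply: sumr_ge0 => k /andP[+ _].
by rewrite mem_enum => /asboolP[m ->]; rewrite tdual_mulrn ah mulrn_wge0 ?ler0n.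
Qed.

Lemma root_space_line beta z :
    beta != 0 -> z \in weight_space (t := t) adg beta -> z != 0 ->
  weight_space (t := t) adg beta = <[z]>%VS.
Proof.
move=> b0 zb z0; apply/esym/eqP; rewrite eqEdim -memvE zb dim_vline z0.
exact: mult_root.
Qed.

Lemma coroot_in_line alpha h e f :
    weight_space (t := t) adg alpha = <[e]>%VS ->
    weight_space (t := t) adg (- alpha) = <[f]>%VS -> is_coroot alpha h ->
  exists c, vsval h = c *: lie_br e f.
Proof.
move=> eE fE [hbr _]; apply/vlineP; apply: (subvP _ _ hbr).
apply/span_subvP => _ /allpairsP[[x y] [/= xU yW ->]].
move: (vbasis_mem xU) (vbasis_mem yW); rewrite eE fE.
by move=> /vlineP[k ->] /vlineP[l ->]; rewrite lie_brZl lie_brZr !memvZ ?memv_line.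
Qed.

Lemma root_opp_lines alpha : root alpha -> exists e f,
  weight_space (t := t) adg alpha = <[e]>%VS /\ weight_space (t := t) adg (- alpha) = <[f]>%VS.
Proof.
move=> ra; have a0 : alpha != 0 by case: ra => /eqP.
have [e ea e0] := root_vector ra; have [f fa f0] := root_vector (rootN ra).
by exists e, f; split; apply: root_space_line; rewrite ?oppr_eq0.
Qed.

Lemma coroot_sl2 alpha h : root alpha -> is_coroot alpha h ->
  exists e f, [/\ e \in weight_space (t := t) adg alpha,
    f \in weight_space (t := t) adg (- alpha), vsval h = lie_br e f
    & (alpha h : F) = 2%:R].
Proof.
move=> ra ch; have [e [f [eE fE]]] := root_opp_lines ra.
have [c cE] := coroot_in_line eE fE ch; case: ch => _ ah.
exists (c *: e), f; split=> //; last by rewrite lie_brZl.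
  by rewrite eE memvZ ?memv_line.
by rewrite fE memv_line.
Qed.

Lemma root_coroot_int alpha beta h :
  root alpha -> root beta -> is_coroot alpha h -> exists z : int, (beta h : F) = z%:~R.
Proof.
move=> ra rb ch; have [e [f [ea fa hE ah]]] := coroot_sl2 ra ch.
have [n [b [w bw]]] := adjoint_weight_basis car.
have [x xb x0] := root_vector rb.
have [a [r [_ _ _ E]]] := sl2_weight_string bw ea fa hE ah xb x0.
exists (a%:Z *+ 2 - r%:Z); rewrite rmorphB rmorphMn /= -!pmulrn -E addrK //.
Qed.

End Roots.

(** * Dimension and weights of highest weight modules *)

Section LinearSpan.
Variables (F : fieldType) (V : vectType F).

(** The family spanned may be infinite, as are the words in negative root vectors, so the span is a
    predicate with its own induction instead of a [{vspace V}]. *)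
Inductive lspan (P : V -> Prop) : V -> Prop :=
| lspan_mem x of P x : lspan P x
| lspan0 : lspan P 0
| lspanD x y of lspan P x & lspan P y : lspan P (x + y)
| lspanZ a x of lspan P x : lspan P (a *: x).

Lemma lspan_sum (P : V -> Prop) (I : Type) (r : seq I) (Q : pred I) (f : I -> V) :
  (forall i, Q i -> lspan P (f i)) -> lspan P (\sum_(i <- r | Q i) f i).
Proof. by move=> fP; apply: big_ind => //; [apply: lspan0 | apply: lspanD]. Qed.

Lemma lspan_lin (P Q : V -> Prop) (u : 'End(V)) x :
  (forall y, P y -> lspan Q (u y)) -> lspan P x -> lspan Q (u x).
Proof.
move=> PQ; elim=> [y /PQ //||y z _ Hy _ Hz|a y _ Hy].
- by rewrite linear0; apply: lspan0.
- by rewrite linearD; apply: lspanD.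
- by rewrite linearZ; apply: lspanZ.
Qed.

Lemma lspan_trans (P Q : V -> Prop) x :
  (forall y, P y -> lspan Q y) -> lspan P x -> lspan Q x.
Proof.
by move=> PQ; have := @lspan_lin P Q \1%VF x; rewrite id_lfunE; apply=> y; rewrite id_lfunE; apply: PQ.
Qed.

Lemma lspan_span (P : V -> Prop) (s : seq V) : {in s, forall x, lspan P x} ->
  exists2 X : seq V, {in X, forall y, P y} & {subset s <= <<X>>%VS}.
Proof.
elim: s => [_|x s IH sP]; first by exists [::].
have [|X XP sX] := IH; first by move=> y ys; apply: sP; rewrite inE ys orbT.
have [Y YP xY] : exists2 Y : seq V, {in Y, forall y, P y} & x \in <<Y>>%VS.
  elim: (sP x (mem_head _ _)) => [y Py||y z _ [Y YP yY] _ [Z ZP zZ]|a y _ [Y YP yY]].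
  - by exists [:: y]; [move=> z; rewrite inE => /eqP -> | rewrite memv_span ?mem_head].
  - by exists [::]; rewrite ?mem0v.
  - exists (Y ++ Z); first by move=> u; rewrite mem_cat => /orP[/YP|/ZP].
    by rewrite span_cat; apply: memv_add.
  - by exists Y => //; apply: memvZ.
exists (Y ++ X); first by move=> y; rewrite mem_cat => /orP[/YP|/XP].
move=> y; rewrite inE span_cat => /orP[/eqP->|/sX yX].
  exact: (subvP (addvSl _ _)).
exact: (subvP (addvSr _ _)).
Qed.

(** Among the finite subfamilies, one whose span has maximal dimension absorbs every further element
    of the family. *)
Lemma lspan_vspace (P : V -> Prop) :
  exists W : {vspace V}, forall x, x \in W <-> lspan P x.
Proof.
pose good d := `[< exists2 X : seq V, {in X, forall y, P y} & \dim <<X>>%VS = d >].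
have ex : exists d, good d.
  by exists 0%N; apply/asboolP; exists [::]; rewrite // span_nil dimv0.
have bnd d : good d -> (d <= \dim {:V})%N.
  by move=> /asboolP[X _ <-]; rewrite dimvS ?subvf.
have [d /asboolP[X XP dX] dmax] := ex_maxnP ex bnd.
exists <<X>>%VS => x; split=> [xX|].
  rewrite (coord_span (X := in_tuple X) xX); apply: lspan_sum => i _.
  by apply/lspanZ/lspan_mem/XP/mem_nth.
have XS y : P y -> y \in <<X>>%VS.
  move=> Py; have : good (\dim <<y :: X>>%VS).
    apply/asboolP; exists (y :: X) => // z; rewrite inE => /orP[/eqP->//|/XP //].
  move/dmax; rewrite -dX span_cons => dle.
  have : (<<X>> == <[y]> + <<X>>)%VS by rewrite eqEdim addvSr.
  by move/eqP => ->; apply: (subvP (addvSl _ _)); rewrite memv_line.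
by elim=> [y /XS //||y z _ yX _ zX|a y _ yX]; rewrite ?mem0v ?memvD ?memvZ.
Qed.

End LinearSpan.

Section HighestWeight.
Variables (F : numFieldType) (g : lieAlgebra F) (t : {vspace g}).
Local Notation tdual := 'Hom(subvs_of t, F^o).
Local Notation adg := (adjoint_rep g).
Local Notation root := Defs.root.
Implicit Types (V : lieRep g) (mu alpha beta : tdual) (h : subvs_of t).
Hypothesis (red : reductive g) (car : cartan_subalgebra t).
Variables (Phip : {fset tdual}) (h0 : subvs_of t).
Hypothesis h0P : forall alpha : tdual, root alpha -> 0 < (alpha h0 : F) \/ (alpha h0 : F) < 0.
Hypothesis PhipP : forall alpha : tdual, alpha \in Phip <-> root alpha /\ 0 < (alpha h0 : F).
Variables (n : nat) (b : n.-tuple adg) (w : 'I_n -> tdual).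
Hypothesis bw : weight_basis b w.

Definition negative i := (w i h0 : F) < 0.

Lemma weight_basis_neq0 i : tnth b i != 0.
Proof.
apply: contraTneq isT => b0; have /eqP := weight_basis_coord bw i i.
by rewrite b0 linear0 eqxx eq_sym oner_eq0.
Qed.

Lemma weight_basis_root i : w i != 0 -> root (w i).
Proof. by move=> wi; apply: root_of_weight_vector wi (weight_basis_weight bw i) (weight_basis_neq0 i). Qed.

(** Root spaces being lines, i |-> - w i is injective on the negative indices, with values in the
    positive roots. *)
Lemma card_negative : (#|negative| <= #|` Phip|)%N.
Proof.
have neg0 i : negative i -> w i != 0.
  by apply: contraTneq => w0; rewrite /negative w0 zero_lfunE ltxx.
rewrite cardE -(size_map (fun i => - w i)); apply: uniq_leq_size.
  rewrite map_inj_in_uniq ?enum_uniq // => i j; rewrite !mem_enum => ni nj /oppr_inj wij.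
  have := mult_root red car (neg0 i ni).
  rewrite (mult_weight_basis bw) => /card_le1_eqP le1.
  by apply: le1; rewrite inE // -wij.
move=> _ /mapP[i + ->]; rewrite mem_enum => ni; apply/PhipP; split.
  by apply: (rootN red car); apply: weight_basis_root; apply: neg0.
by rewrite opp_lfunE oppr_gt0.
Qed.

Section Words.
Variables (V : lieRep g) (v : V).

(** The head letter acts last: in a sorted word the smallest letter is the outermost operator. *)
Definition word_act (s : seq 'I_n) : V := foldr (fun i => rep_act V (tnth b i)) v s.

Definition word_le k (x : V) : Prop :=
  exists s : seq 'I_n, [/\ all negative s, (size s <= k)%N & x = word_act s].

Definition sorted_word (x : V) : Prop :=
  exists s : seq 'I_n, [/\ all negative s, sorted (fun i j : 'I_n => i <= j)%N s & x = word_act s].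

Lemma negative_bracket i j : negative i -> negative j ->
  forall k, coord b k (lie_br (tnth b i) (tnth b j)) != 0 -> negative k.
Proof.
move=> ni nj k ck; have wk : w k = w j + w i.
  apply: (coord_weight bw _ ck).
  exact: (rep_act_weight (V := adg) (weight_basis_weight bw i) (weight_basis_weight bw j)).
by rewrite /negative wk add_lfunE -[ltRHS]addr0 ltrD.
Qed.

Lemma word_le_act i k x :
  negative i -> lspan (word_le k) x -> lspan (word_le k.+1) (rep_act V (tnth b i) x).
Proof.
move=> ni; apply: lspan_lin => _ [s [ns sk ->]]; apply: lspan_mem.
by exists (i :: s); rewrite /= ni.
Qed.

Local Notation leI := (fun i j : 'I_n => (i <= j)%N).

(* Moving a letter into its place changes a word only by shorter words. *)
Lemma word_insert i s : negative i -> all negative s ->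
  lspan (word_le (size s)) (rep_act V (tnth b i) (word_act s) - word_act (merge leI [:: i] s)).
Proof.
move=> ni; elim: s => [_|j s IH] /=; first by rewrite subrr; apply: lspan0.
case/andP=> nj ns; case: ifP => _; first by rewrite subrr; apply: lspan0.
set u := word_act s.
have -> : rep_act V (tnth b i) (rep_act V (tnth b j) u) =
    rep_act V (tnth b j) (rep_act V (tnth b i) u) +
    rep_act V (lie_br (tnth b i) (tnth b j)) u by rewrite rep_act_br addrC subrK.
rewrite addrAC -[word_act (j :: _)]/(rep_act V _ (word_act _)) -linearB.
apply: lspanD; first by apply: word_le_act => //; apply: IH.
rewrite (weight_basis_sum bw (lie_br _ _)) linear_sum sum_lfunE.
apply: lspan_sum => k _; rewrite linearZ scale_lfunE.
have [->|ck] := eqVneq (coord b k (lie_br (tnth b i) (tnth b j))) 0.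
  by rewrite scale0r; apply: lspan0.
apply: lspanZ; apply: word_le_act; first exact: negative_bracket ck.
by apply: lspan_mem; exists s.
Qed.

Lemma word_sort s : all negative s ->
  exists s', [/\ all negative s', sorted leI s', size s' = size s &
    lspan (word_le (size s).-1) (word_act s - word_act s')].
Proof.
elim: s => [_|i s IH /= /andP[ni ns]].
  by exists [::]; split=> //; rewrite subrr; apply: lspan0.
have [s' [ns' ss' szs' E]] := IH ns; exists (merge leI [:: i] s'); split.
- by rewrite all_merge /= ni ns'.
- by apply: merge_sorted => // x y; apply: leq_total.
- by rewrite size_merge /= szs'.
rewrite -[word_act s](subrK (word_act s')) linearD /= -addrA; apply: lspanD.
  case: s {IH ns} szs' E => [|j s] szs' E; last exact: word_le_act.
  by case: s' szs' {ns' ss'} E => // _ _; rewrite subrr linear0; apply: lspan0.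
by rewrite -szs'; apply: word_insert.
Qed.

(** The spanning half of the Poincare-Birkhoff-Witt theorem: the errors made in sorting are shorter
    words, to which induction on the length applies. *)
Lemma word_sorted s : all negative s -> lspan sorted_word (word_act s).
Proof.
elim: (size s).+1 {-2}s (ltnSn (size s)) => // k IH {}s sk ns.
have [s' [ns' ss' szs' E]] := word_sort ns.
rewrite -[word_act s](subrK (word_act s')); apply: lspanD; last by apply: lspan_mem; exists s'.
case: s sk szs' ns E => [|i s] sk szs' ns E.
  by case: s' szs' {ns' ss'} E => // _ _; rewrite subrr; apply: lspan0.
apply: lspan_trans E => _ [r [nr rs ->]]; apply: IH => //.
exact: leq_ltn_trans rs sk.
Qed.

(** The negative words span a submodule: any x can be commuted through the letters down to v, which
    t scales and the positive root vectors kill. Irreducibility makes this span everything; sorting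
    the words and discarding dependent ones leaves the basis. *)
Lemma highest_weight_basis (lambda : tdual) :
    irreducible V -> v != 0 -> v \in weight_space V lambda ->
    (forall alpha x, alpha \in Phip ->
        x \in weight_space (t := t) adg alpha -> rep_act V x v = 0) ->
  exists d (bV : d.-tuple V) (s : 'I_d -> seq 'I_n),
    basis_of fullv bV /\ forall i, [/\ all negative (s i), sorted leI (s i)
      & tnth bV i = word_act (s i)].
Proof.
move=> [_ irr] v0 vl hw.
pose word x := exists s, all negative s /\ x = word_act s.
have actw i x : negative i -> lspan word x -> lspan word (rep_act V (tnth b i) x).
  move=> ni; apply: lspan_lin => _ [s [ns ->]]; apply: lspan_mem.
  by exists (i :: s); rewrite /= ni.
have gw x s : all negative s -> lspan word (rep_act V x (word_act s)).
  elim: s x => [|j s IH] x /= => [_|/andP[nj ns]].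
    rewrite (weight_basis_sum bw x) linear_sum sum_lfunE; apply: lspan_sum => k _.
    rewrite linearZ scale_lfunE; apply: lspanZ.
    have wv : lspan word v by apply: lspan_mem; exists [::].
    have [w0|wk] := eqVneq (w k) 0.
      have kt : tnth b k \in t by rewrite -(weight_space0 car) -w0; apply: (weight_basis_weight bw).
      by rewrite -(vsprojK kt) (weight_spaceE _ vl); apply: lspanZ.
    have [pk|nk] := h0P (weight_basis_root wk); last exact: actw.
    rewrite (hw (w k)) ?(weight_basis_weight bw) //; first exact: lspan0.
    by apply/PhipP; split=> //; apply: weight_basis_root.
  have -> : rep_act V x (rep_act V (tnth b j) (word_act s)) =
      rep_act V (tnth b j) (rep_act V x (word_act s)) +
      rep_act V (lie_br x (tnth b j)) (word_act s) by rewrite rep_act_br addrC subrK.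
  by apply: lspanD; [apply: actw => //|]; apply: IH.
have [W WP] := lspan_vspace word.
have WV : W = fullv.
  case: (irr W) => [x y /WP yW||//].
    by apply/WP; apply: lspan_lin yW => _ [s [ns ->]]; apply: gw.
  move=> W0; have : v \in W by apply/WP/lspan_mem; exists [::].
  by rewrite W0 memv0 (negPf v0).
have sp : {in (vbasis fullv : seq V), forall x, lspan sorted_word x}.
  move=> x _; have : x \in W by rewrite WV memvf.
  by move/WP; apply: lspan_trans => _ [s [ns ->]]; apply: word_sorted.
have [X XP sX] := lspan_span sp.
have [Y [sYX fY eY]] := free_subseq_span X.
have YP (i : 'I_(size Y)) : exists s, [/\ all negative s, sorted leI s
    & tnth (in_tuple Y) i = word_act s].
  by apply/XP/sYX; rewrite mem_tnth.
have [s sP] := fin_all_exists YP.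
exists (size Y), (in_tuple Y), s; split=> //.
rewrite /basis_of fY andbT eY eqEsubv subvf /= -(span_basis (vbasisP fullv)).
by apply/span_subvP.
Qed.

Lemma word_act_weight (lambda : tdual) s : v \in weight_space V lambda ->
  word_act s \in weight_space V (lambda + \sum_(i <- s) w i).
Proof.
move=> vl; elim: s => [|i s IH]; first by rewrite big_nil addr0.
rewrite big_cons [w i + _]addrC addrA.
by apply: rep_act_weight (weight_basis_weight bw i) IH.
Qed.

End Words.
End HighestWeight.

(** * Linear bounds on exponents and weights, polynomial bound on the dimension *)

Section Growth.
Variables (F : numFieldType) (g : lieAlgebra F) (t : {vspace g}).
Local Notation tdual := 'Hom(subvs_of t, F^o).
Local Notation adg := (adjoint_rep g).
Local Notation root := Defs.root.
Implicit Types (V : lieRep g) (mu alpha beta lambda : tdual) (h : subvs_of t).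
Hypothesis archF : Num.archimedean_axiom F.
Hypothesis (red : reductive g) (car : cartan_subalgebra t).
Variables (Phip : {fset tdual}) (h0 : subvs_of t).
Hypothesis h0P : forall alpha : tdual, root alpha -> 0 < (alpha h0 : F) \/ (alpha h0 : F) < 0.
Hypothesis PhipP : forall alpha : tdual, alpha \in Phip <-> root alpha /\ 0 < (alpha h0 : F).
Variables (n : nat) (b : n.-tuple adg) (w : 'I_n -> tdual).
Hypothesis bw : weight_basis b w.

Local Notation neg := (negative h0 w).
Local Notation leI := (fun i j : 'I_n => (i <= j)%N).

Definition highest_weight_vector V (v : V) (lambda : tdual) : Prop :=
  [/\ v != 0, v \in weight_space V lambda & forall alpha x, alpha \in Phip ->
        x \in weight_space (t := t) adg alpha -> rep_act V x v = 0].

Lemma highest_weight_weights V (v u : V) lambda nu :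
    irreducible V -> highest_weight_vector v lambda ->
    u \in weight_space V nu -> u != 0 ->
  exists2 s, all neg s & nu = lambda + \sum_(i <- s) w i.
Proof.
move=> irr [v0 vl vk] un u0.
have [d [bV [s [bVb sP]]]] := highest_weight_basis car h0P PhipP bw irr v0 vl vk.
have bVw : weight_basis bV (fun i => lambda + \sum_(j <- s i) w j).
  by split=> // i; have [_ _ ->] := sP i; apply: word_act_weight.
have [i ui] : exists i, coord bV i u != 0.
  apply: contrapT => nu0; move/eqP: u0; apply.
  rewrite (weight_basis_sum bVw u) big1 // => i _.
  have [->|ui] := eqVneq (coord bV i u) 0; first by rewrite scale0r.
  by case: nu0; exists i.
by exists (s i); [have [] := sP i | rewrite (coord_weight bVw un ui)].
Qed.

Lemma archimedean_bound (I : finType) (f : I -> F) :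
  exists M : nat, forall i, `|f i| <= M%:R.
Proof.
have ex i : exists m : nat, `|f i| < m%:R by exact: archF.
have [m mP] := fin_all_exists ex; exists (\sum_i m i)%N => i.
by apply: le_trans (ltW (mP i)) _; rewrite ler_nat (bigD1 i) //= leq_addr.
Qed.

Lemma tdual_sum (s : seq 'I_n) h : ((\sum_(i <- s) w i) h : F) = \sum_(i <- s) (w i h : F).
Proof. by rewrite sum_lfunE. Qed.

Lemma sum_weight_bound (M : nat) (f : 'I_n -> F) s :
  (forall i, `|f i| <= M%:R) -> `|\sum_(i <- s) f i| <= (M * size s)%:R.
Proof.
move=> fM; apply: le_trans (ler_norm_sum _ _ _) _.
elim: s => [|i s IH]; first by rewrite big_nil muln0.
by rewrite big_cons /= mulnS natrD lerD.
Qed.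

Lemma sum_negative_le0 s : all neg s -> \sum_(i <- s) (w i h0 : F) <= 0.
Proof.
move/allP => ns; rewrite big_seq; apply: sumr_le0 => i /ns; exact: ltW.
Qed.

(* If f^a u <> 0 with u of weight mu, there are a' >= a and r such that
   e^r f^a' u <> 0 and 2 a' = mu(h) + r.  No weight exceeds [lambda *+ m] at [h0],
   which bounds r - a', hence also a' = mu(h) + (r - a'). *)
Lemma exponent_bound lambda i : neg i ->
  exists A : nat, forall m V (v : V), irreducible V -> highest_weight_vector v (lambda *+ m) ->
    forall s a, all neg s -> iter a (rep_act V (tnth b i)) (word_act b v s) != 0 ->
  (a <= A * (m + size s))%N.
Proof.
move=> ni; have wi0 : w i != 0.
  by apply: contraTneq ni => wi; rewrite /negative wi zero_lfunE ltxx.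
have xw := weight_basis_weight bw i.
have [y yw [h' hE' wh']] := root_sl2 red car wi0 xw (weight_basis_neq0 bw i).
(* The triple starts from the lowering vector [tnth b i]. Passing to beta = - w i and h = - h'
   exchanges the roles, so that y raises and beta is positive at h0. *)
pose h := - h'; have [beta betaE] : exists beta, beta = - w i by exists (- w i).
rewrite -betaE in yw.
have hE : vsval h = lie_br y (tnth b i) by rewrite linearN /= hE' [RHS]lie_brC.
have bh : (beta h : F) = 2%:R by rewrite betaE opp_lfunE linearN /= opprK.
have xb : tnth b i \in weight_space (t := t) adg (- beta) by rewrite betaE opprK.
have b0 : 0 < (beta h0 : F) by rewrite betaE opp_lfunE oppr_gt0.
have [L LP] := archimedean_bound (fun _ : 'I_1 => lambda h : F).
have [M MP] := archimedean_bound (fun j => w j h : F).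
have [D DP] := archimedean_bound (fun j => (w j h0 : F) / beta h0).
(* The inequalities 2 a' <= r + L m + M |s| and r <= a' + D |s| obtained below add up to a' <= L m +
   (M + D) |s|. *)
exists (L + M + D)%N => m V v irr hwv s a ns fa0.
have [v0 vl vk] := hwv.
have [d [bV [sV [bVb sVP]]]] := highest_weight_basis car h0P PhipP bw irr v0 vl vk.
have bVw : weight_basis bV (fun i => lambda *+ m + \sum_(j <- sV i) w j).
  by split=> // j; have [_ _ ->] := sVP j; apply: word_act_weight.
have uw := word_act_weight bw s vl; set u := word_act b v s in fa0 uw *.
set mu := _ + _ in uw.
have u0 : u != 0.
  by apply: contra_neq fa0 => ->; elim: a => //= a ->; rewrite linear0.
have [a' [r [f1 f2 er E]]] := sl2_weight_string bVw yw xb hE bh uw u0.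
have aa' : (a <= a')%N.
  rewrite leqNgt; apply: contra_neqN fa0 => lt; rewrite -(subnK lt) iterD f1.
  by elim: (a - a'.+1)%N => //= k ->; rewrite linear0.
have zw := rep_act_iter_weight r yw (rep_act_iter_weight a' xb uw).
have [s' ns' sE] := highest_weight_weights irr hwv zw er.
(* The weight of e^r f^a' u equals lambda *+ m plus a sum of negative roots. At h0 this gives (r -
   a') beta(h0) + (sum over s of the w j (h0)) <= 0, which is divided by beta(h0). *)
have rle : (r <= a' + D * size s)%N.
  have := congr1 (fun f : tdual => f h0 : F) sE.
  rewrite /mu !(add_lfunE, tdual_mulrn, tdual_sum, opp_lfunE) mulNrn => /eqP.
  rewrite -!addrA (inj_eq (addrI _)) => /eqP sE0.
  have S := sum_negative_le0 ns'; rewrite -sE0 in S.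
  have : (r%:R : F) <= a'%:R + (D * size s)%:R.
    rewrite -(ler_pM2r b0) mulrDl !mulr_natl.
    move: S; rewrite addrA -lerBrDr sub0r lerNr => S.
    apply: le_trans S _; rewrite opprB lerD2l.
    have X0 : \sum_(j <- s) ((w j h0 : F) / beta h0) <= 0.
      rewrite -mulr_suml mulr_le0_ge0 ?invr_ge0 ?(ltW b0) //.
      exact: sum_negative_le0.
    have := sum_weight_bound s DP; rewrite ler0_norm // -mulr_suml -mulNr.
    by rewrite ler_pdivrMr // mulr_natl.
  by rewrite -natrD ler_nat.
have mule : (a' * 2 <= r + (L * m + M * size s))%N.
  have muE : (mu h : F) = a'%:R *+ 2 - r%:R by apply/eqP; rewrite -subr_eq opprK E.
  have mur : (mu h : F) \is Num.real by rewrite muE -mulr_natr -natrM realB ?realn.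
  have muN : `|mu h| <= (L * m + M * size s)%:R :> F.
    rewrite add_lfunE tdual_mulrn tdual_sum natrD.
    apply: le_trans (ler_normD _ _) _; apply: lerD; last exact: sum_weight_bound.
    by rewrite normrMn natrM -[leLHS]mulr_natr ler_wpM2r ?ler0n // (LP ord0).
  rewrite -(ler_nat F) natrM mulr_natr -E natrD addrC lerD2l.
  exact: le_trans (real_ler_norm mur) muN.
have le1 : (a' <= L * m + M * size s + D * size s)%N by clear - rle mule; lia.
apply: leq_trans aa' (leq_trans le1 _); rewrite !mulnDl !mulnDr; clear; lia.
Qed.

Lemma sorted_split (i : 'I_n) (s : seq 'I_n) : sorted leI s -> all (leq i) (map val s) ->
  exists a s', [/\ s = nseq a i ++ s', sorted leI s' & all (leq i.+1) (map val s')].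
Proof.
elim: s => [|x s IH] /=; first by exists 0%N, [::].
move=> ps /andP[ix ils]; have [xi|xi] := eqVneq x i.
  have [a [s' [-> ss' is']]] := IH (path_sorted ps) ils.
  by exists a.+1, s'; rewrite xi.
exists 0%N, (x :: s); split=> //=.
have ix' : (i < x)%N by rewrite ltn_neqAle ix andbT eq_sym xi.
rewrite ix' all_map; apply: sub_all (order_path_min _ ps) => [y /= xy|? ? ?].
  exact: leq_trans ix' xy.
exact: leq_trans.
Qed.

(** A sorted word is a power of its smallest letter applied to a word in the larger ones. By
    [exponent_bound] that power is at most A times (m + the remaining size), so admitting one more
    letter multiplies size + m by at most A + 1. The induction is on the number k of letters
    allowed, those of index at least n - k. *)
Lemma sorted_word_size lambda : exists C : nat,
  forall m V (v : V), irreducible V -> highest_weight_vector v (lambda *+ m) ->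
    forall s, all neg s -> sorted leI s -> word_act b v s != 0 ->
  (size s <= C * m)%N.
Proof.
have exA i : exists A : nat, neg i ->
    forall m V (v : V), irreducible V -> highest_weight_vector v (lambda *+ m) ->
    forall s a, all neg s -> iter a (rep_act V (tnth b i)) (word_act b v s) != 0 ->
  (a <= A * (m + size s))%N.
  have [ni|nni] := boolP (neg i); last by exists 0%N.
  by have [A AP] := exponent_bound lambda ni; exists A.
have [Af AfP] := fin_all_exists exA; pose A := (\sum_i Af i)%N.
exists (A.+1 ^ n)%N => m V v irr hwv s ns ss s0.
suff H k : (k <= n)%N -> forall s, all neg s -> sorted leI s ->
    all (leq (n - k)) (map val s) -> word_act b v s != 0 ->
    (size s + m <= A.+1 ^ k * m)%N.
  apply: leq_trans (leq_addr m _) _; apply: H => //.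
  by rewrite subnn; apply/allP.
move=> {s ns ss s0}; elim: k => [|k IH] kn s ns ss als s0.
  case: s {ns ss s0} als => [_|x s]; first by rewrite mul1n.
  by rewrite /= subn0 leqNgt ltn_ord.
have ltn : (n - k.+1 < n)%N by rewrite -subn_gt0; lia.
pose i := Ordinal ltn; have [a [s' [sE ss' als']]] := sorted_split (i := i) ss als.
have word_iter r : word_act b v (nseq a i ++ r) = iter a (rep_act V (tnth b i)) (word_act b v r).
  by elim: a {sE} => //= a ->.
have ns' : all neg s' by move: ns; rewrite sE all_cat => /andP[].
have s'0 : word_act b v s' != 0.
  apply: contra_neq s0 => s'0; rewrite sE word_iter s'0.
  by elim: a {sE word_iter} => //= a ->; rewrite linear0.
have {}IH : (size s' + m <= A.+1 ^ k * m)%N.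
  by apply: IH => //; [exact: ltnW | have -> : (n - k = i.+1)%N by rewrite /=; lia].
have aA : (a <= A * (m + size s'))%N.
  case: a => // a in sE word_iter *.
  have ni : neg i by move: ns; rewrite sE /= => /andP[].
  apply: leq_trans (AfP i ni m V v irr hwv s' a.+1 ns' _) _.
    by rewrite -word_iter -sE.
  by rewrite leq_mul2r /A (bigD1 i) //= leq_addr orbT.
rewrite sE size_cat size_nseq expnS -mulnA.
apply: leq_trans (_ : _ <= A.+1 * (size s' + m))%N _; first by rewrite mulSn; lia.
by rewrite leq_mul2l IH orbT.
Qed.

Lemma highest_weight_growth lambda : exists C : nat,
  forall m V, irreducible V -> highest_weight Phip V (lambda *+ m) ->
  exists d (bV : d.-tuple V) (wV : 'I_d -> tdual), [/\ weight_basis bV wV,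
    (d <= (C * m).+1 ^ #|` Phip|)%N
    & forall i (j : 'I_(rk t)), `|wV i (tnth (tbasis t) j) : F| <= (C * m)%:R].
Proof.
have [C CP] := sorted_word_size lambda.
have [L LP] := archimedean_bound (fun j => lambda (tnth (tbasis t) j) : F).
have [M MP] := archimedean_bound (fun p : 'I_n * 'I_(rk t) => w p.1 (tnth (tbasis t) p.2) : F).
(* L and M * C bound the contributions of lambda and of at most C m letters to a weight; the last C
   serves the dimension. *)
exists (L + M * C + C)%N => m V irr [v [v0 vl vk]].
have hwv : highest_weight_vector v (lambda *+ m) by split.
have [d [bV [s [bVb sP]]]] := highest_weight_basis car h0P PhipP bw irr v0 vl vk.
have bVw : weight_basis bV (fun i => lambda *+ m + \sum_(j <- s i) w j).
  by split=> // j; have [_ _ ->] := sP j; apply: word_act_weight.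
have szs i : (size (s i) <= C * m)%N.
  have [ns ss sE] := sP i; apply: (CP m V v irr hwv) => //.
  by rewrite -sE (basis_not0 bVb) ?mem_tnth.
exists d, bV, (fun i => lambda *+ m + \sum_(j <- s i) w j); split=> //.
- apply: (@leq_trans ((C * m).+1 ^ #|` Phip|)%N); last first.
    by case: #|` Phip| => // N; rewrite leq_exp2r // ltnS leq_mul2r leq_addl orbT.
  apply: leq_trans (leq_pexp2l _ (card_negative red car PhipP bw)) => //.
  have -> : #|neg| = #|{: {i | neg i}}| by rewrite card_sig.
  rewrite -[X in (X ^ _)%N](card_ord (C * m).+1) -card_ffun -[X in (X <= _)%N](card_ord d).
  (* [f] records how often each letter occurs. These counts determine a sorted word, and distinct
     basis vectors come from distinct words, so [f] is injective; no count exceeds C m, so [inord]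
     loses nothing. *)
  pose f i := [ffun k : {i | neg i} => inord (count_mem (val k) (s i)) : 'I_(C * m).+1].
  apply: (@leq_card _ _ f) => i j /ffunP fij.
  have cE k : count_mem k (s i) = count_mem k (s j).
    have [nk|nk] := boolP (neg k); last first.
      have c0 l : count_mem k (s l) = 0%N.
        apply/count_memPn; apply: contra nk => ks.
        by have [/allP ns _ _] := sP l; apply: ns.
      by rewrite !c0.
    have := congr1 (@nat_of_ord _) (fij (Sub k nk)); rewrite !ffunE SubK !inordK // ltnS.
      exact: leq_trans (count_size _ _) (szs j).
    exact: leq_trans (count_size _ _) (szs i).
  have sij : s i = s j.
    have [_ si _] := sP i; have [_ sj _] := sP j.
    apply: (sorted_eq (leT := leI)) si sj _.
    - by move=> x y z; apply: leq_trans.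
    - by move=> x y /anti_leq/val_inj.
    - by apply/allP => k _; rewrite /= cE.
  have [_ _ bi] := sP i; have [_ _ bj] := sP j.
  apply/ord_inj/eqP; rewrite -(nth_uniq 0 _ _ (free_uniq (basis_free bVb))) ?size_tuple //.
  by rewrite -!tnth_nth bi bj sij.
- move=> i j; rewrite add_lfunE tdual_mulrn tdual_sum.
  apply: le_trans (ler_normD _ _) _.
  apply: (@le_trans _ _ ((L * m)%:R + (M * size (s i))%:R)).
    apply: lerD; first by rewrite normrMn natrM -[leLHS]mulr_natr ler_wpM2r ?ler0n // LP.
    by apply: sum_weight_bound => k; apply: (MP (k, j)).
  by rewrite -natrD ler_nat; rewrite !mulnDl -mulnA -addnA leq_add2l (leq_trans _ (leq_addr _ _)) // leq_mul2l szs orbT.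
Qed.

End Growth.

(** * Polynomials: vanishing, growth and symmetric functions *)

Section MpolyVanishing.

Lemma digits_inj B r (a c : 'I_r -> nat) :
    (forall i, a i < B)%N -> (forall i, c i < B)%N ->
    (\sum_i a i * B ^ i = \sum_i c i * B ^ i)%N -> a =1 c.
Proof.
elim: r a c => [|r IH] a c aB cB; first by move=> _ [].
have E (f : 'I_r.+1 -> nat) : (\sum_i f i * B ^ i = f ord0 + B * \sum_(i < r) f (lift ord0 i) * B ^ i)%N.
  rewrite big_ord_recl muln1; congr addn; rewrite big_distrr /=.
  by apply: eq_bigr => i _; rewrite /bump /= add1n expnS mulnCA.
rewrite !E => S; have B0 : (0 < B)%N by apply: leq_trans (aB ord0).
have S0 : a ord0 = c ord0.
  have := congr1 (modn^~ B) S; rewrite /= ![(_ + B * _)%N]addnC ![(B * _)%N]mulnC.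
  by rewrite !modnMDl !modn_small.
move: S; rewrite S0 => /addnI/eqP; rewrite eqn_mul2l gtn_eqF //= => /eqP S.
have {}IH := IH _ _ (fun i => aB (lift ord0 i)) (fun i => cB (lift ord0 i)) S.
by move=> i; case: (unliftP ord0 i) => [j|] -> //; apply: IH.
Qed.

Variable (K : idomainType).
Hypothesis charK : forall k : nat, (k%:R == 0 :> K) = (k == 0)%N.

(** A domain rather than a field, because the coefficients are later taken in Sym(t^* ) as well as
    in F. *)
Lemma poly_nat_eq0 (q : {poly K}) : (forall k : nat, q.[k%:R] = 0) -> q = 0.
Proof.
move=> q0; apply/eqP; apply: contraTT isT => qn0.
have natI : injective (fun k : nat => k%:R : K).
  move=> i j E; wlog ij : i j E / (i <= j)%N.
    by move=> H; case: (leqP i j) => [|/ltnW] /H ->.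
  apply/eqP; rewrite eqn_leq ij -subn_eq0 -charK natrB // E subrr eqxx //.
suff : (size q < size q)%N by rewrite ltnn.
rewrite -{1}(size_iota 0 (size q)) -(size_map (fun k => k%:R : K)).
apply: max_poly_roots => //; last by rewrite map_inj_uniq // iota_uniq.
by apply/allP => _ /mapP[k _ ->]; apply/rootP.
Qed.

(* Kronecker substitution: x_i = k ^ (B ^ i), with B exceeding all exponents. *)
Lemma mpoly_nat_eq0 r (f : {mpoly K[r]}) :
  (forall a : 'I_r -> nat, f.@[fun i => (a i)%:R] = 0) -> f = 0.
Proof.
move=> f0; pose B := msize f.
have mB m i : m \in msupp f -> (m i < B)%N.
  move=> mf; apply: leq_ltn_trans (msize_mdeg_lt mf).
  by rewrite mdegE (bigD1 i) //= leq_addr.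
pose code (m : 'X_{1..r}) := (\sum_(i < r) m i * B ^ i)%N.
pose q := \sum_(m <- msupp f) f@_m *: 'X^(code m).
have q0 : q = 0.
  apply: poly_nat_eq0 => k; rewrite -(f0 (fun i => k ^ (B ^ i))%N) mevalE horner_sum.
  apply: eq_bigr => m _; rewrite hornerZ hornerXn; congr (_ * _).
  rewrite /code expr_sum; apply: eq_bigr => i _.
  by rewrite natrX -exprM mulnC.
apply/mpolyP => m; rewrite mcoeff0.
have [mf|/memN_msupp_eq0 //] := boolP (m \in msupp f).
have := congr1 (fun p : {poly K} => p`_(code m)) q0.
rewrite coef0 coef_sum (bigD1_seq m) ?msupp_uniq //= coefZ coefXn eqxx mulr1.
rewrite big_seq_cond big1 ?addr0 // => m' /andP[m'f m'm].
rewrite coefZ coefXn; case: eqP => [E|]; last by rewrite mulr0.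
case/eqP: m'm; apply/mnmP => i; symmetry.
by apply: (digits_inj (B := B) (a := m) (c := m')) => // j; apply: mB.
Qed.

(* The coefficients in T of f(T v) are the homogeneous components of f at v. *)
Lemma mpoly_ray r (f : {mpoly K[r]}) (v : 'I_r -> K) :
  exists2 q : {poly K}, (forall x, q.[x] = f.@[fun i => x * v i])
    & forall j, q`_j = (pihomog mdeg j f).@[v].
Proof.
exists (\sum_(m <- msupp f) (f@_m * \prod_i v i ^+ m i) *: 'X^(mdeg m)) => [x|j].
  rewrite mevalE horner_sum; apply: eq_bigr => m _.
  rewrite hornerZ hornerXn -mulrA; congr (_ * _).
  by rewrite mdegE -prodrXr -big_split /=; apply: eq_bigr => i _; rewrite exprMn mulrC.
rewrite coef_sum pihomogE linear_sum big_mkcond /= [RHS]big_mkcond; apply: eq_bigr => m _.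
rewrite coefZ coefXn eq_sym; case: eqP => _; last by rewrite mulr0.
by rewrite mulr1 mevalZ mevalX.
Qed.

Lemma msize_pihomog r (f : {mpoly K[r]}) d :
  (forall j, (d < j)%N -> pihomog mdeg j f = 0) -> (msize f <= d.+1)%N.
Proof.
move=> f0; rewrite msizeE; apply/bigmax_leqP_seq => m mf _; rewrite ltnS leqNgt.
apply: contraL mf => dm; rewrite -mcoeff_eq0; apply/eqP; rewrite -[RHS](mcoeff0 _ m) -(f0 _ dm).
rewrite pihomogE raddf_sum /=; have [mf|mf] := boolP (m \in msupp f).
  rewrite big_mkcond (bigD1_seq m) ?msupp_uniq //= eqxx linearZ /= mcoeffX eqxx mulr1.
  rewrite big1 ?addr0 // => m' /negPf m'm; case: ifP => // _.
  by rewrite linearZ /= mcoeffX m'm mulr0.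
rewrite (memN_msupp_eq0 mf) big_seq_cond big1 // => m' /andP[m'f _].
rewrite linearZ /= mcoeffX; case: eqP => [E|]; last by rewrite mulr0.
by rewrite -E m'f in mf.
Qed.

End MpolyVanishing.

Section PolynomialGrowth.
Variable (F : numFieldType).
Hypothesis archF : Num.archimedean_axiom F.

Lemma size_poly_growth (q : {poly F}) (B D : nat) :
  (forall k : nat, `|q.[k%:R]| <= (B * k.+1 ^ D)%:R) -> (size q <= D.+1)%N.
Proof.
move=> qB; rewrite leqNgt; apply/negP => Dq.
have [d szq] : exists d, size q = d.+2 by case: (size q) Dq => [|[|d]] // _; exists d.
have Dd : (D <= d)%N by rewrite szq !ltnS in Dq.
have l0 : lead_coef q != 0 by rewrite lead_coef_eq0 -size_poly_eq0 szq.
(* At the point k + 1 the hypothesis gives B (k + 2)^D <= B 2^D (k + 1)^d, and the terms below the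
   leading one sum to at most (k + 1)^d times the sum of their coefficients in norm. Dividing by (k
   + 1)^d bounds |lead_coef q| (k + 1) by [K] for every k. *)
pose K := (B * 2 ^ D)%:R + \sum_(i < d.+1) `|q`_i| : F.
have bound k : `|lead_coef q| * k.+1%:R <= K.
  have kd0 : 0 < k.+1%:R ^+ d :> F by rewrite exprn_gt0 // ltr0n.
  rewrite -(ler_pM2r kd0) -mulrA -exprS mulrDl.
  have -> : `|lead_coef q| * k.+1%:R ^+ d.+1 =
      `|q.[k.+1%:R] - \sum_(i < d.+1) q`_i * k.+1%:R ^+ i|.
    rewrite horner_coef szq big_ord_recr /= addrAC subrr add0r normrM normrX normr_nat.
    by rewrite lead_coefE szq.
  apply: le_trans (ler_normB _ _) _; apply: lerD.
    apply: le_trans (qB _) _; rewrite -natrX -natrM ler_nat -mulnA leq_mul2l.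
    apply/orP; right; apply: (@leq_trans (2 ^ D * k.+1 ^ D)); last first.
      by rewrite leq_mul2l leq_pexp2l ?orbT.
    rewrite -expnMn; case: (D) => // D'; rewrite leq_exp2r //; lia.
  apply: le_trans (ler_norm_sum _ _ _) _; rewrite mulr_suml; apply: ler_sum => i _.
  rewrite normrM normrX normr_nat ler_wpM2l ?normr_ge0 //.
  by rewrite -!natrX ler_nat leq_pexp2l // -ltnS.
have [k kP] := archF (K / `|lead_coef q|).
have := bound k; rewrite mulrC -ler_pdivlMr ?normr_gt0 // => kK.
have K0 : 0 <= K by rewrite addr_ge0 ?ler0n // sumr_ge0.
move: kP; rewrite ger0_norm ?divr_ge0 // => /(le_lt_trans kK).
by rewrite ltr_nat ltnNge leqnSn.
Qed.

End PolynomialGrowth.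

(** * Newton's identities *)

Section Newton.
Variable (R : comNzRingType).

Fixpoint elem_sym (s : seq R) (k : nat) : R :=
  match s, k with
  | _, 0 => 1
  | [::], _.+1 => 0
  | x :: s', k'.+1 => elem_sym s' k + x * elem_sym s' k'
  end.

Lemma elem_sym0 s : elem_sym s 0 = 1. Proof. by case: s. Qed.

Lemma elem_sym_cons x s k : elem_sym (x :: s) k.+1 = elem_sym s k.+1 + x * elem_sym s k.
Proof. by []. Qed.

Arguments elem_sym : simpl never.

Lemma elem_sym_oversize s k : (size s < k)%N -> elem_sym s k = 0.
Proof.
elim: s k => [|x s IH] [|k] //; rewrite ltnS => sk.
by rewrite elem_sym_cons !IH ?mulr0 ?addr0 // (leq_trans sk).
Qed.

Lemma prod_elem_sym s : \prod_(x <- s) (1 + x) = \sum_(k < (size s).+1) elem_sym s k.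
Proof.
elim: s => [|x s IH]; first by rewrite big_nil big_ord1.
rewrite big_cons IH mulrDl mul1r [X in X + _ = _]big_ord_recl [RHS]big_ord_recl !elem_sym0 -addrA; congr (_ + _).
under [RHS]eq_bigr do rewrite elem_sym_cons.
rewrite big_split mulr_sumr /= [in RHS]big_ord_recr /= elem_sym_oversize // addr0.
by congr (_ + _); apply: eq_bigr => i _.
Qed.

Lemma newton_elem_sym s k :
  k.+1%:R * elem_sym s k.+1 =
    \sum_(i < k.+1) (-1) ^+ i * elem_sym s (k - i) * \sum_(x <- s) x ^+ i.+1.
Proof.
elim: s k => [|x s IH] k.
  by rewrite mulr0 big1 // => i _; rewrite big_nil mulr0.
(* [T] collects the terms in which the power of the new element x meets the old elementary
   functions. By [TS] it telescopes: T (j + 1) + x T j leaves only x e_(j+1)(s), the term missing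
   from the induction hypotheses. *)
pose T k := \sum_(i < k.+1) (-1) ^+ i * elem_sym s (k - i) * x ^+ i.+1.
have TS j : T j.+1 = elem_sym s j.+1 * x - x * T j.
  rewrite /T big_ord_recl subn0 expr0 mul1r expr1; congr (_ + _).
  rewrite mulr_sumr -sumrN; apply: eq_bigr => i _.
  rewrite lift0 subSS exprS [x ^+ i.+2]exprS; ring.
have sE : \sum_(i < k.+1) (-1) ^+ i * elem_sym (x :: s) (k - i) * \sum_(y <- x :: s) y ^+ i.+1 =
    \sum_(i < k.+1) (-1) ^+ i * elem_sym s (k - i) * \sum_(y <- s) y ^+ i.+1 + T k +
    (if k is j.+1 then x * (\sum_(i < j.+1) (-1) ^+ i * elem_sym s (j - i) * \sum_(y <- s) y ^+ i.+1 + T j) else 0).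
  case: k => [|j].
    by rewrite !big_ord1 /T big_ord1 big_cons !subnn !elem_sym0 addr0 expr0; ring.
  rewrite big_ord_recr /= subnn elem_sym0 [X in _ = X + _ + _]big_ord_recr /= subnn elem_sym0.
  rewrite /T [X in _ = _ + X + _]big_ord_recr /= subnn elem_sym0.
  rewrite mulrDr !mulr_sumr big_cons.
  have -> : \sum_(i < j.+1) (-1) ^+ i * elem_sym (x :: s) (j.+1 - i) * \sum_(y <- x :: s) y ^+ i.+1 =
    \sum_(i < j.+1) ((-1) ^+ i * elem_sym s (j.+1 - i) * (\sum_(y <- s) y ^+ i.+1)
      + (-1) ^+ i * elem_sym s (j.+1 - i) * x ^+ i.+1
      + (x * ((-1) ^+ i * elem_sym s (j - i) * \sum_(y <- s) y ^+ i.+1)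
      + x * ((-1) ^+ i * elem_sym s (j - i) * x ^+ i.+1))).
    apply: eq_bigr => i _.
    have ij : (i <= j)%N by rewrite -ltnS.
    rewrite big_cons (subSn ij) elem_sym_cons.
    move: ((-1) ^+ i) (elem_sym s _) (elem_sym s _) (x ^+ _) (\sum_(y <- s) _) => c e e' p q.
    by ring.
  rewrite !big_split /=; ring.
rewrite sE -IH elem_sym_cons.
case: k {sE} => [|j].
  by rewrite /T big_ord1 subnn elem_sym0 expr0; ring.
rewrite -IH TS -[j.+2]addn1 natrD; ring.
Qed.

End Newton.

Lemma rmorph_elem_sym (R S : comNzRingType) (f : {rmorphism R -> S}) s k :
  f (elem_sym s k) = elem_sym (map f s) k.
Proof.
elim: s k => [|x s IH] [|k] //=; rewrite ?rmorph1 ?rmorph0 //.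
by rewrite rmorphD rmorphM !IH.
Qed.

Lemma elem_sym_dhomog (R : comNzRingType) r (s : seq {mpoly R[r]}) k :
  {in s, forall x, x \is 1.-homog} -> elem_sym s k \is k.-homog.
Proof.
elim: s k => [|x s IH] [|k] sh /=; rewrite ?rpred0 ?dhomog1 //.
have {}IH l : elem_sym s l \is l.-homog by apply: IH => y ys; apply: sh; rewrite inE ys orbT.
by rewrite rpredD // -[k.+1]add1n dhomogM // sh ?mem_head.
Qed.

Lemma pihomog_prod (R : comNzRingType) r (s : seq {mpoly R[r]}) k :
  {in s, forall x, x \is 1.-homog} ->
  pihomog mdeg k (\prod_(x <- s) (1 + x)) = elem_sym s k.
Proof.
move=> sh; rewrite prod_elem_sym linear_sum /=.
have [ks|sk] := ltnP k (size s).+1.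
  rewrite (bigD1 (Ordinal ks)) //= pihomog_dE ?elem_sym_dhomog // big1 ?addr0 // => i ik.
  by apply: (pihomog_ne0 _ (elem_sym_dhomog i sh)); apply: contraNneq ik => ik; apply/eqP/val_inj.
rewrite elem_sym_oversize // big1 // => i _; apply: (pihomog_ne0 _ (elem_sym_dhomog i sh)).
by rewrite neq_ltn (leq_trans (ltn_ord i) sk).
Qed.

(** Strong induction on Newton's identity, whose factor k + 1 on the left only helps. The exponent
    [D] is kept abstract so that both bounds for E_k are instances, and the first alternative
    discards power sums that vanish identically. *)
Lemma elem_sym_growth (F : numFieldType) (s : nat -> seq F) (N : nat) (D : nat -> nat) :
    (forall i, exists B : nat, forall m, `|\sum_(x <- s m) x ^+ i.+1| <= (B * m.+1 ^ (N + i.+1))%:R) ->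
    (forall k i, (i <= k)%N -> (forall m, \sum_(x <- s m) x ^+ i.+1 = 0) \/
      (D (k - i) + (N + i.+1) <= D k.+1)%N) ->
  forall k, exists B : nat, forall m, `|elem_sym (s m) k| <= (B * m.+1 ^ D k)%:R.
Proof.
move=> pB DP k; have [k0] := ubnP k; elim: k0 k => // k0 IH [_|k].
  by exists 1%N => m; rewrite elem_sym0 normr1 mul1n ler1n expn_gt0.
rewrite ltnS => kk0.
have eB (i : 'I_k.+1) : exists B : nat, forall m,
    `|elem_sym (s m) (k - i) * \sum_(x <- s m) x ^+ i.+1| <= (B * m.+1 ^ D k.+1)%:R.
  have [p0|Dle] := DP k i (leq_ord i).
    by exists 0%N => m; rewrite p0 mulr0 normr0 mul0n.
  have [B BP] := pB i; have [|B' B'P] := IH (k - i)%N; first lia.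
  exists (B' * B)%N => m; rewrite normrM; apply: le_trans (ler_pM _ _ (B'P m) (BP m)) _ => //.
  by rewrite -natrM ler_nat mulnACA -expnD leq_mul2l leq_pexp2l ?orbT.
have [B BP] := fin_all_exists eB; exists (\sum_i B i)%N => m.
apply: (@le_trans _ _ `|k.+1%:R * elem_sym (s m) k.+1|).
  by rewrite normrM normr_nat ler_peMl // ler1n.
rewrite newton_elem_sym; apply: le_trans (ler_norm_sum _ _ _) _.
rewrite big_distrl /= natr_sum; apply: ler_sum => i _.
by rewrite -mulrA normrM normrX normrN1 expr1n mul1r.
Qed.

(** * Density of the dominant elements *)

Section Dominant.
Variables (F : numFieldType) (g : lieAlgebra F) (t : {vspace g}).
Local Notation tdual := 'Hom(subvs_of t, F^o).
Local Notation adg := (adjoint_rep g).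
Local Notation root := Defs.root.
Implicit Types (V : lieRep g) (mu alpha beta lambda : tdual) (h : subvs_of t).
Hypothesis archF : Num.archimedean_axiom F.
Hypothesis (red : reductive g) (car : cartan_subalgebra t).
Variables (Phip : {fset tdual}) (h0 : subvs_of t).
Hypothesis h0P : forall alpha : tdual, root alpha -> 0 < (alpha h0 : F) \/ (alpha h0 : F) < 0.
Hypothesis PhipP : forall alpha : tdual, alpha \in Phip <-> root alpha /\ 0 < (alpha h0 : F).
Variables (n : nat) (b : n.-tuple adg) (w : 'I_n -> tdual).
Hypothesis bw : weight_basis b w.

(** Both elements lie on the line of [e, f] and alpha takes the value 2 on each. *)
Lemma coroot_uniq alpha h h' : root alpha -> is_coroot alpha h -> is_coroot alpha h' -> h = h'.
Proof.
move=> ra ch ch'; have [e [f [eE fE]]] := root_opp_lines red car ra.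
have [c cE] := coroot_in_line eE fE ch; have [c' c'E] := coroot_in_line eE fE ch'.
case: ch ch' => _ ah [_ ah'].
have c0 : c != 0.
  apply: contra_eq_neq ah => c0; have -> : h = 0 by apply/val_inj; rewrite /= cE c0 scale0r.
  by rewrite linear0 eq_sym pnatr_eq0.
have hh' : h' = (c' / c) *: h.
  apply/val_inj; rewrite -[LHS]/(vsval h') -[RHS]/(vsval ((c' / c) *: h)).
  by rewrite linearZ /= cE c'E scalerA divfK.
have /eqP := ah'; rewrite hh' linearZ /= -[X in X == _]/(c' / c * alpha h) ah.
rewrite -[X in _ == X]mul1r => /eqP/(mulIf _) -> //; first by rewrite scale1r.
by rewrite pnatr_eq0.
Qed.

Lemma eventually_forall_seq (T : eqType) (s : seq T) (Q : T -> nat -> Prop) :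
  {in s, forall x, exists m0 : nat, forall m, (m0 <= m)%N -> Q x m} ->
  exists m0 : nat, forall m, (m0 <= m)%N -> {in s, forall x, Q x m}.
Proof.
elim: s => [|x s IH] sQ; first by exists 0%N.
have [|m1 m1P] := IH; first by move=> y ys; apply: sQ; rewrite inE ys orbT.
have [m2 m2P] := sQ x (mem_head _ _); exists (maxn m1 m2) => m; rewrite geq_max => /andP[le1 le2] y.
by rewrite inE => /orP[/eqP->|ys]; [apply: m2P|apply: m1P].
Qed.

Lemma real_lerN_norm (x : F) : x \is Num.real -> - x <= `|x|.
Proof. by move=> xr; rewrite -normrN real_ler_norm ?realN. Qed.

(** A shift by some m > |x| makes x positive; the predecessor of the least natural number exceeding
    x + m then serves as its floor. *)
Lemma int_approx (x : F) : x \is Num.real -> exists k : int, `|x - k%:~R| <= 1.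
Proof.
move=> xr; have [m mx] := archF x.
have yr : x + m%:R \is Num.real by rewrite realD ?realn.
have ex : exists j : nat, x + m%:R < j%:R.
  exists (m + m)%N; rewrite natrD ltrD2r; exact: le_lt_trans (real_ler_norm xr) mx.
case: (ex_minnP ex) => [[|j]] yj jmin.
  have : x + m%:R < 0 by [].
  rewrite -ltrBrDr sub0r ltrNr => mx'.
  by have := lt_trans mx' (le_lt_trans (real_lerN_norm xr) mx); rewrite ltxx.
have jy : j%:R <= x + m%:R.
  by rewrite real_leNgt ?realn //; apply/negP => /jmin; rewrite ltnn.
exists (j%:Z - m%:Z); rewrite rmorphB /= -!pmulrn ger0_norm; last first.
  by rewrite opprB addrA subr_ge0.
by rewrite opprB addrA lerBlDr nat1r ltW.
Qed.

Lemma integralD lambda mu : integral lambda -> integral mu -> integral (lambda + mu).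
Proof.
move=> il im alpha h ra ch; have [z zE] := il _ _ ra ch; have [z' z'E] := im _ _ ra ch.
by exists (z + z'); rewrite add_lfunE zE z'E intrD.
Qed.

Lemma integralMz lambda (k : int) : integral lambda -> integral (lambda *~ k).
Proof.
move=> il alpha h ra ch; have [z zE] := il _ _ ra ch.
by exists (z * k); rewrite tdual_mulrz zE -mulrzA.
Qed.

Lemma integral0 : integral (0 : tdual).
Proof. by move=> alpha h _ _; exists 0; rewrite zero_lfunE. Qed.

Lemma dominantD lambda mu : dominant Phip lambda -> dominant Phip mu -> dominant Phip (lambda + mu).
Proof.
move=> [il dl] [im dm]; split; first exact: integralD.
by move=> alpha h aP ch; rewrite add_lfunE addr_ge0 ?(dl alpha) ?(dm alpha).
Qed.

Lemma dominant0 : dominant Phip 0.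
Proof. by split; [exact: integral0 | move=> *; rewrite zero_lfunE]. Qed.

Lemma dominantMn lambda k : dominant Phip lambda -> dominant Phip (lambda *+ k).
Proof.
by move=> dl; elim: k => [|k IH]; [exact: dominant0 | rewrite mulrS; apply: dominantD].
Qed.

Lemma weight_integral i : integral (w i).
Proof.
have [->|wi] := eqVneq (w i) 0; first exact: integral0.
move=> alpha h ra ch; apply: (root_coroot_int red car ra) ch.
exact: (weight_basis_root bw).
Qed.

(** The sum is K(h0, h) = alpha(h0) K(e, f) by invariance. Moreover 2 K(e, f) = K(h, h) is a sum of
    squares of integers containing alpha(h)^2 = 4, hence positive. *)
Lemma positive_root_coroot alpha h : alpha \in Phip -> is_coroot alpha h ->
  0 < \sum_i (w i h0 : F) * (w i h : F).
Proof.
move=> /PhipP[ra ah0] ch; have [e [f [ea fa hE ah]]] := coroot_sl2 red car ra ch.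
have key h' : \sum_i (w i h : F) * (w i h' : F) = (alpha h' : F) * killing b e f.
  rewrite -(killing_cartan bw) hE (killing_invariant bw).
  have -> : lie_br f (vsval h') = (alpha h' : F) *: f.
    rewrite lie_brC [lie_br _ _](weight_spaceE _ fa) opp_lfunE scaleNr opprK //.
  by rewrite (killingC bw) killingZl (killingC bw).
have K0 : 0 < killing b e f.
  rewrite -(pmulr_rgt0 _ (_ : 0 < 2%:R :> F)) ?ltr0n // -ah -key.
  have [k wk] : exists k, w k = alpha by apply: (weight_basis_mult_gt0 bw); case: ra.
  rewrite (bigD1 k) //= wk ah ltr_pwDl ?mulr_gt0 ?ltr0n // sumr_ge0 // => i _.
  by have [z ->] := weight_integral i ra ch; rewrite -intrM ler0z -expr2 sqr_ge0.
have -> : \sum_i (w i h0 : F) * (w i h : F) = (alpha h0 : F) * killing b e f.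
  by rewrite -key; apply: eq_bigr => i _; rewrite mulrC.
by rewrite mulr_gt0.
Qed.

(* An integral approximation of a large multiple of killing(h0, -), which is
   positive on the positive coroots. *)
Lemma strictly_dominant_exists : exists2 lambda0 : tdual, integral lambda0 &
  forall alpha h, alpha \in Phip -> is_coroot alpha h -> 1 <= (lambda0 h : F).
Proof.
(* [Q] quantifies over all roundings k, because one m must be found for all positive roots before
   the rounding at that m is chosen. *)
pose Q (alpha : tdual) (m : nat) := forall k : 'I_n -> int,
  (forall i, `|m%:R * (w i h0 : F) - (k i)%:~R| <= 1) ->
  forall h, is_coroot alpha h -> 0 < ((\sum_i w i *~ k i : tdual) h : F).
have Qev : {in enum_fset Phip, forall alpha, exists m0 : nat, forall m, (m0 <= m)%N -> Q alpha m}.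
  move=> alpha aP; have ra : root alpha by have /PhipP[] := aP.
  have [[h ch]|nch] := pselect (exists h, is_coroot alpha h); last first.
    by exists 0%N => m _ k _ h ch; case: nch; exists h.
  have s0 := positive_root_coroot aP ch; set s := \sum_i _ in s0.
  pose S := \sum_i `|w i h : F|.
  (* Rounding changes the value at h by at most S, which m s exceeds as soon as m > S / s. *)
  have [m0 m0P] := archF (S / s); exists m0 => m mm k kP h' ch'.
  rewrite -(coroot_uniq ra ch ch') sum_lfunE.
  under eq_bigr do rewrite tdual_mulrz -mulrzl.
  have -> : \sum_i (k i)%:~R * (w i h : F) = m%:R * s -
      \sum_i (m%:R * (w i h0 : F) - (k i)%:~R) * (w i h : F).
    rewrite /s mulr_sumr -sumrB; apply: eq_bigr => i _; ring.
  have wr i : (w i h : F) \is Num.real.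
    by have [z ->] := weight_integral i ra ch; rewrite realz.
  rewrite subr_gt0.
  have : S < m%:R * s.
    rewrite -ltr_pdivrMr //; apply: lt_le_trans (_ : m0%:R <= _); last by rewrite ler_nat.
    have Sr : S \is Num.real by apply: sum_real => i _; apply: normr_real.
    by apply: le_lt_trans m0P; apply: real_ler_norm; rewrite realM ?realV ?(gtr0_real s0).
  apply: le_lt_trans; apply: le_trans (real_ler_norm _) _.
    apply: sum_real => i _; rewrite realM // realB ?realz //.
    rewrite realM ?realn //.
    have [->|wi] := eqVneq (w i) 0; first by rewrite zero_lfunE real0.
    by case: (h0P (weight_basis_root bw wi)) => [/gtr0_real|/ltr0_real].
  apply: le_trans (ler_norm_sum _ _ _) _; apply: ler_sum => i _.
  by rewrite normrM ler_piMl.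
have [m mP] := eventually_forall_seq Qev.
have w0r i : (w i h0 : F) \is Num.real.
  have [->|wi] := eqVneq (w i) 0; first by rewrite zero_lfunE real0.
  by case: (h0P (weight_basis_root bw wi)) => [/gtr0_real|/ltr0_real].
have kex i : exists k : int, `|m%:R * (w i h0 : F) - k%:~R| <= 1.
  by apply: int_approx; rewrite realM ?realn.
have [k kP] := fin_all_exists kex.
have il : integral (\sum_i w i *~ k i : tdual).
  apply: (big_ind (@integral F g t)); [exact: integral0 | exact: integralD |].
  by move=> i _; apply/integralMz/weight_integral.
exists (\sum_i w i *~ k i) => // alpha h aP ch.
have ra : root alpha by have /PhipP[] := aP.
have := mP m (leqnn m) alpha aP k kP h ch.
by have [z ->] := il _ _ ra ch; rewrite ltr0z ler1z.
Qed.

(* An element of t killed by all integral weights is central, and it lies in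
   [g, g] because the functionals vanishing on [g, g] are integral. *)
Lemma dominant_separates x :
  (forall lambda, dominant Phip lambda -> (lambda x : F) = 0) -> x = 0.
Proof.
move=> dx; have [l0 il0 l0P] := strictly_dominant_exists.
have l0x : (l0 x : F) = 0.
  by apply: dx; split=> // alpha h aP ch; apply: le_trans ler01 (l0P alpha h aP ch).
have ix mu : integral mu -> (mu x : F) = 0.
  move=> im.
  (* An integral mu becomes dominant after adding a large multiple of l0; since l0 and mu + m l0
     both vanish at x, so does mu. *)
  pose Q (alpha : tdual) (m : nat) := forall h, is_coroot alpha h -> 0 <= ((mu + l0 *+ m) h : F).
  have Qev : {in enum_fset Phip, forall alpha, exists m0 : nat, forall m, (m0 <= m)%N -> Q alpha m}.
    move=> alpha aP; have ra : root alpha by have /PhipP[] := aP.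
    have [[h ch]|nch] := pselect (exists h, is_coroot alpha h); last first.
      by exists 0%N => m _ h ch; case: nch; exists h.
    have [m0 m0P] := archF (mu h); exists m0 => m mm h' ch'.
    rewrite -(coroot_uniq ra ch ch') add_lfunE tdual_mulrn -[mu h]opprK addrC subr_ge0.
    have mur : (mu h : F) \is Num.real by have [z ->] := im _ _ ra ch; rewrite realz.
    apply: (le_trans (real_lerN_norm mur)); apply: le_trans (ltW m0P) _.
    apply: (@le_trans _ _ (m%:R : F)); first by rewrite ler_nat.
    by rewrite lerMn2r (l0P alpha h aP ch) orbT.
  have [m mP] := eventually_forall_seq Qev.
  have dm : dominant Phip (mu + l0 *+ m).
    split; first by apply: integralD => //; rewrite pmulrn; apply: integralMz.
    by move=> alpha h aP; apply: (mP m (leqnn m) alpha aP).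
  by have := dx _ dm; rewrite add_lfunE tdual_mulrn l0x mul0rn addr0.
have xc (y : g) : lie_br (vsval x) y = 0.
  rewrite (weight_basis_sum bw y) /lie_br linear_sum big1 // => i _.
  rewrite linearZ /= [lie_ad _ _ _](weight_spaceE _ (weight_basis_weight bw i)).
  by rewrite (ix _ (weight_integral i)) scale0r scaler0.
apply/val_inj; rewrite linear0.
apply: (reductive_center_derived red) xc; set U := lie_brv _ _.
apply: contrapT => /negP xU.
(* [p] vanishes exactly on U = [g, g]. Its coordinates restricted to t are zero on all coroots,
   hence integral, hence zero at x; were x outside U, one of them would not be. *)
pose p (z : g) := z - projv U z.
have [i pi] : exists i, coord (vbasis (fullv : {vspace g})) i (p (vsval x)) != 0.
  apply: contrapT => ni; move/negP: xU; apply.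
  have p0 : p (vsval x) = 0.
    rewrite (coord_vbasis (memvf (p (vsval x)))) big1 // => i _.
    have [->|ci] := eqVneq (coord (vbasis fullv) i (p (vsval x))) 0; first by rewrite scale0r.
    by case: ni; exists i.
  by move/eqP: p0; rewrite subr_eq0 => /eqP ->; apply: memv_proj.
pose f h : F^o := coord (vbasis (fullv : {vspace g})) i (p (vsval h)).
have fl : linear f.
  by move=> a y z; rewrite /f /p !linearP /= addrACA -scalerDr linearP.
pose f' : {linear subvs_of t -> F^o} := HB.pack f (GRing.isLinear.Build _ _ _ _ f fl).
have fx := ix (linfun f'); rewrite (lfunE f') /= in fx.
move/eqP: pi; apply; apply: fx.
move=> alpha h ra [hbr _]; exists 0; rewrite (lfunE f') /= /f /p.
rewrite projv_id ?subrr ?linear0 //.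
apply: (subvP _ _ hbr); apply/span_subvP => _ /allpairsP[[y z] [_ _ ->]] /=.
by rewrite lie_br_in_brv ?memvf.
Qed.

(** Rows are added one at a time: fewer than rk t of them annihilate a common nonzero y in t, and a
    dominant element that does not vanish at y is independent of them. *)
Lemma dominant_matrix : exists2 A : 'M[F]_(rk t), A \in unitmx &
  forall i, exists2 lambda, dominant Phip lambda & forall j, A i j = lambda (tnth (tbasis t) j).
Proof.
pose good r (A : 'M[F]_(r, rk t)) := row_free A /\
  forall i, exists2 lambda, dominant Phip lambda & forall j, A i j = lambda (tnth (tbasis t) j).
suff [A [Af AP]] : exists A : 'M_(rk t), good (rk t) A by exists A; rewrite // -row_free_unit.
suff H r : (r <= rk t)%N -> exists A : 'M_(r, rk t), good r A by apply: H.
elim: r => [|r IH] rt.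
  by exists 0; split; [rewrite /row_free mxrank0 | case].
have [A [Af AP]] := IH (ltnW rt).
have [x xA x0] : exists2 x : 'rV_(rk t), x *m A^T = 0 & x != 0.
  have : kermx A^T != 0.
    by rewrite -mxrank_eq0 mxrank_ker mxrank_tr (eqP Af) subn_eq0 -ltnNge.
  by case/rowV0Pn => x /sub_kermxP xA x0; exists x.
pose y := \sum_j x 0 j *: tnth (tbasis t) j.
have y0 : y != 0.
  apply: contra_neq x0 => y0; apply/rowP => j; rewrite mxE.
  have := congr1 (coord (tbasis t) j) y0; rewrite linear0 linear_sum (bigD1 j) //=.
  have tf : free (tbasis t) by apply: basis_free (vbasisP _).
  rewrite big1 => [|k kj]; rewrite linearZ /= (tnth_nth 0) coord_free //.
    by rewrite eqxx mulr1 addr0.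
  by rewrite (negPf kj) mulr0.
have [l dl ly] : exists2 lambda, dominant Phip lambda & (lambda y : F) != 0.
  apply: contrapT => nl; move/eqP: y0; apply; apply: dominant_separates => l dl.
  by apply: contrapT => /eqP ly; apply: nl; exists l.
pose v := \row_j (l (tnth (tbasis t) j) : F).
have vx : v *m x^T != 0.
  apply: contra_neq ly => vx; have := congr1 (fun M : 'M_1 => M 0 0) vx.
  rewrite !mxE => vx0; rewrite /y linear_sum -[RHS]vx0; apply: eq_bigr => j _.
  by rewrite linearZ /= !mxE mulrC.
have vA : ~~ (v <= A)%MS.
  apply: contra vx => /submxP[u ->].
  by rewrite -mulmxA -[A *m _]trmxK trmx_mul trmxK xA trmx0 mulmx0.
exists (col_mx v A : 'M_(1 + r, _)); split.
  have lt : (A < v + A)%MS by rewrite ltmxE addsmxSr /= addsmx_sub submx_refl andbT.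
  have rE : \rank (col_mx v A) = \rank (v + A)%MS by rewrite addsmxE.
  have := rank_leq_row (col_mx v A); move: lt; rewrite ltmxErank (eqP Af) -rE => /andP[_ ge le].
  by apply/eqP/anti_leq; rewrite le ge.
move=> i; have iE := splitK (i : 'I_(1 + r)).
case: split iE => k <-.
  by exists l => // j; rewrite -[LHS]/((col_mx v A) (lshift r k) j) col_mxEu mxE.
have [mu dm muE] := AP k; exists mu => // j.
by rewrite -[LHS]/((col_mx v A) (rshift 1 k) j) col_mxEd.
Qed.

End Dominant.

(** * Degree bounds *)

Section WeightSums.
Variables (F : numFieldType) (g : lieAlgebra F) (t : {vspace g}).
Local Notation tdual := 'Hom(subvs_of t, F^o).
Variables (V : lieRep g) (d : nat) (b : d.-tuple V) (w : 'I_d -> tdual).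
Hypothesis bw : weight_basis b w.

(** [h] abstracts the [mult]-fold iterate of [f], a multiple in the power sums and a power in the
    total class. Its support lies in the finite image of [w]. *)
Lemma big_weights (R : Type) (idx : R) (op : Monoid.com_law idx) (f : tdual -> R)
    (h : tdual -> R) :
    (forall mu, h mu = \big[op/idx]_(i | w i == mu) f mu) ->
  \big[op/idx]_(mu \in [set: tdual]%classic) h mu = \big[op/idx]_i f (w i).
Proof.
move=> hE; rewrite (fsbigTE [fset w i | i in 'I_d]%fset); last first.
  move=> mu muA; rewrite hE big_pred0 // => i; apply: contraNF muA => /eqP <-.
  by apply/imfsetP; exists i.
under eq_bigr => mu _.
  rewrite hE (eq_bigr (fun i => f (w i))); last by move=> i /eqP ->.
  rewrite big_mkcond; over.
rewrite exchange_big /=; apply: eq_bigr => i _; rewrite -big_mkcond /=.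
rewrite -big_filter (_ : [seq mu <- _ | w i == mu] = [:: w i]) ?big_seq1 //.
rewrite (eq_filter (a2 := pred1 (w i))); last by move=> mu; rewrite /= eq_sym.
by rewrite filter_pred1_uniq ?fset_uniq //; apply/imfsetP; exists i.
Qed.

Lemma power_sum_weights k : power_sum t k V = \sum_i tsym (w i) ^+ k.
Proof.
rewrite /power_sum (big_weights (f := fun mu => tsym mu ^+ k)) // => mu.
by rewrite (mult_weight_basis bw) sumr_const.
Qed.

Lemma total_class_weights : total_class t V = \prod_i (1 + tsym (w i)).
Proof.
rewrite /total_class (big_weights (f := fun mu => 1 + tsym mu)) // => mu.
by rewrite (mult_weight_basis bw) prodr_const.
Qed.

Lemma tsym_dhomog (mu : tdual) : tsym mu \is 1.-homog.
Proof. by apply: rpred_sum => i _; apply: rpredZ; rewrite dhomogX /= mdeg1. Qed.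

Lemma elem_sum_weights k : elem_sum t k V = elem_sym [seq tsym (w i) | i <- enum 'I_d] k.
Proof.
rewrite /elem_sum total_class_weights -(@pihomog_prod _ _ [seq tsym (w i) | i <- enum 'I_d]).
  by rewrite big_map big_enum.
by move=> _ /mapP[i _ ->]; apply: tsym_dhomog.
Qed.

(** The sum is the trace of h, and the trace of a representation vanishes on brackets. It gives the
    vanishing of the first power sum in the semisimple case. *)
Lemma sum_weights_perfect (h : subvs_of t) :
  lie_brv (fullv : {vspace g}) fullv = fullv -> \sum_i (w i h : F) = 0.
Proof.
move=> perf; pose tau (x : g) : F^o := \sum_i coord b i (rep_act V x (tnth b i)).
have taul : linear tau.
  move=> a x y; rewrite /tau scaler_sumr -big_split; apply: eq_bigr => i _ /=.
  by rewrite linearP add_lfunE scale_lfunE linearP.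
pose tau' : {linear g -> F^o} := HB.pack tau (GRing.isLinear.Build _ _ _ _ tau taul).
have -> : \sum_i (w i h : F) = tau' (vsval h).
  apply: eq_bigr => i _; rewrite (weight_spaceE _ (weight_basis_weight bw i)) linearZ /=.
  by rewrite (weight_basis_coord bw) eqxx mulr1.
have : vsval h \in lker (linfun tau').
  apply: (subvP _ _ (_ : vsval h \in lie_brv fullv fullv)); last by rewrite perf memvf.
  apply/span_subvP => _ /allpairsP[[x y] [_ _ ->]] /=.
  rewrite memv_ker (lfunE tau') /= /tau; apply/eqP.
  have bE u : u \in <<b>>%VS by case: bw => /span_basis -> _; rewrite memvf.
  rewrite -[RHS](subrr (\sum_i coord b i (rep_act V x (rep_act V y (tnth b i))))).
  rewrite [X in _ = _ - X]trace_commutator // -sumrB; apply: eq_bigr => i _.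
  by rewrite rep_act_br linearB.
by rewrite memv_ker (lfunE tau') /= => /eqP.
Qed.

End WeightSums.

Section Degrees.
Variables (F : numFieldType) (g : lieAlgebra F) (t : {vspace g}).
Local Notation tdual := 'Hom(subvs_of t, F^o).
Local Notation adg := (adjoint_rep g).
Hypothesis archF : Num.archimedean_axiom F.
Hypothesis (red : reductive g) (car : cartan_subalgebra t).
Variables (Phip : {fset tdual}).
Hypothesis pos : positive_roots Phip.

Lemma mpoly_charf0 r k : (k%:R == 0 :> {mpoly F[r]}) = (k == 0)%N.
Proof. by rewrite -mpolyC_nat mpolyC_eq0 pnatr_eq0. Qed.

Lemma dominant_dense (f : symA t) :
  (forall lambda, dominant Phip lambda -> symA_eval f lambda = 0) -> f = 0.
Proof.
move=> f0; have [h0 [h0P PhipP]] := pos.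
have [n [b [w bw]]] := adjoint_weight_basis car.
have [A Au AP] := dominant_matrix archF red car h0P PhipP bw.
have exl i : exists l : tdual, dominant Phip l /\ forall j, A i j = l (tnth (tbasis t) j).
  by have [l dl lE] := AP i; exists l.
have [lam lamP] := fin_all_exists exl.
(* [f'] is f in the coordinates attached to the [lam i]. A point with natural coordinates is a sum
   of dominant elements, so f vanishes there. *)
pose f' := f \mPo [tuple \sum_i (A i j)%:MP *: 'X_i | j < rk t].
have f'E u : f'.@[u] = f.@[fun j => \sum_i (A i j)%:MP * u i].
  rewrite comp_mpoly_meval; apply: meval_eq => j.
  by rewrite tnth_mktuple linear_sum; apply: eq_bigr => i _; rewrite /= mevalZ mevalXU.
have f'0 : f' = 0.
  apply: mpoly_nat_eq0 => [|c]; first exact: mpoly_charf0.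
  rewrite f'E -[RHS](f0 (\sum_i lam i *+ c i)); last first.
    apply: (big_ind (dominant Phip)); [exact: dominant0 | exact: dominantD |].
    by move=> i _; apply: dominantMn; have [] := lamP i.
  apply: meval_eq => j; rewrite sum_lfunE [RHS]raddf_sum; apply: eq_bigr => i _ /=.
  have [_ ->] := lamP i.
  by rewrite tdual_mulrn -mpolyC_nat -mpolyCM mulr_natr.
apply: mpoly_nat_eq0 => [|c]; first exact: mpoly_charf0.
(* The substitution is undone at c: the entries of the row c times [invmx A] are the coordinates in
   which [f'] takes the value f(c). *)
pose u i : {mpoly F[rk t]} := (\sum_l (c l)%:R * invmx A l i)%:MP.
rewrite -[RHS](meval0 u) -f'0 f'E; apply: meval_eq => j.
under eq_bigr do rewrite -mpolyCM.
rewrite -raddf_sum -mpolyC_nat; congr (_%:MP).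
have AV l : \sum_i invmx A l i * A i j = (l == j)%:R.
  by have := congr1 (fun M : 'M_(rk t) => M l j) (mulVmx Au); rewrite !mxE.
under eq_bigr do rewrite mulr_sumr.
rewrite exchange_big /= (bigD1 j) //= [X in _ + X]big1 => [|l lj].
  under eq_bigr do rewrite mulrCA [_ * invmx _ _ _]mulrC.
  by rewrite -mulr_sumr AV eqxx mulr1 addr0.
under eq_bigr do rewrite mulrCA [_ * invmx _ _ _]mulrC.
by rewrite -mulr_sumr AV (negPf lj) mulr0.
Qed.

(** Two specializations reduce to a polynomial in one variable over F: restriction to the ray
    through lambda, and evaluation of the coefficients in Sym(t^* ) at a natural point a. Its values
    at m are those bounded in the hypothesis. *)
Lemma degree_of_growth (f : symA t) (phi : tdual -> {mpoly F[rk t]}) (D : nat) :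
    extends_dominant Phip f phi ->
    (forall lambda (a : 'I_(rk t) -> nat), dominant Phip lambda -> exists B : nat,
      forall m, `|(phi (lambda *+ m)).@[fun i => (a i)%:R]| <= (B * m.+1 ^ D)%:R) ->
  deg_le f D.
Proof.
move=> fphi phiB; apply: msize_pihomog => j Dj; apply: dominant_dense => lambda dl.
rewrite /symA_eval; have [q qf qj] := mpoly_ray f (fun i => (lambda (tnth (tbasis t) i))%:MP).
rewrite -qj; apply: mpoly_nat_eq0 => [k|a]; first by rewrite pnatr_eq0.
have [B BP] := phiB lambda a dl.
pose qa := map_poly (meval (fun i => (a i)%:R : F)) q.
rewrite -(coef_map (meval (fun i => (a i)%:R : F))) -/qa.
apply: nth_default; apply: leq_trans Dj; apply: (size_poly_growth archF (B := B)) => m.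
have -> : qa.[m%:R] = (phi (lambda *+ m)).@[fun i => (a i)%:R]; last exact: BP.
rewrite -fphi; last exact: dominantMn.
rewrite /qa -[m%:R](rmorph_nat (meval (fun i => (a i)%:R : F))) horner_map qf.
congr meval; apply: meval_eq => i; rewrite tdual_mulrn.
by rewrite -mpolyC_nat -mpolyCM mulr_natl.
Qed.

Variable phi : tdual -> lieRep g.
Hypothesis phiP : forall lambda, dominant Phip lambda ->
  irreducible (phi lambda) /\ highest_weight Phip (phi lambda) lambda.

Lemma weights_growth lambda (a : 'I_(rk t) -> nat) : dominant Phip lambda ->
  exists C : nat, exists s : nat -> seq F, forall m,
    [/\ (size (s m) <= (C * m).+1 ^ #|` Phip|)%N, {in s m, forall x, `|x| <= (C * m)%:R},
      forall k, (power_sum t k (phi (lambda *+ m))).@[fun i => (a i)%:R] = \sum_(x <- s m) x ^+ k,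
      forall k, (elem_sum t k (phi (lambda *+ m))).@[fun i => (a i)%:R] = elem_sym (s m) k
    & lie_brv (fullv : {vspace g}) fullv = fullv -> \sum_(x <- s m) x = 0].
Proof.
move=> dl; have [h0 [h0P PhipP]] := pos.
have [n [b [w bw]]] := adjoint_weight_basis car.
have [C CP] := highest_weight_growth archF red car h0P PhipP bw lambda.
(* Evaluating at a multiplies the bound on the weights by at most [al]; the successor keeps the
   constant at least C, as the bound on the size requires. *)
pose al := (\sum_i a i)%N; exists (C * al.+1)%N.
suff ex m : exists sm : seq F, [/\ (size sm <= (C * al.+1 * m).+1 ^ #|` Phip|)%N,
      {in sm, forall x, `|x| <= (C * al.+1 * m)%:R},
      forall k, (power_sum t k (phi (lambda *+ m))).@[fun i => (a i)%:R] = \sum_(x <- sm) x ^+ k,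
      forall k, (elem_sum t k (phi (lambda *+ m))).@[fun i => (a i)%:R] = elem_sym sm k
    & lie_brv (fullv : {vspace g}) fullv = fullv -> \sum_(x <- sm) x = 0].
  by have [s sP] := boolp.choice ex; exists s.
have [irr hw] := phiP (dominantMn m dl).
have [d [bV [wV [bVw dC wC]]]] := CP m _ irr hw.
pose ev := meval (fun i => (a i)%:R : F).
have evt (mu : tdual) : ev (tsym mu) = \sum_j (mu (tnth (tbasis t) j) : F) * (a j)%:R.
  by rewrite /ev linear_sum; apply: eq_bigr => j _; rewrite /= mevalZ mevalXU.
exists [seq ev (tsym (wV i)) | i <- enum 'I_d]; split.
- rewrite size_map size_enum_ord (leq_trans dC) //.
  by case: #|` Phip| => // N; rewrite leq_exp2r // ltnS mulnAC leq_pmulr.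
- move=> _ /mapP[i _ ->]; rewrite evt; apply: le_trans (ler_norm_sum _ _ _) _.
  apply: (@le_trans _ _ (\sum_j (C * m)%:R * (a j)%:R)).
    by apply: ler_sum => j _; rewrite normrM normr_nat ler_wpM2r.
  by rewrite -mulr_sumr -natr_sum -natrM ler_nat [leqRHS]mulnAC -/al leq_mul2l leqnSn orbT.
- move=> k; rewrite (power_sum_weights bVw) big_map big_enum linear_sum /=.
  by apply: eq_bigr => i _; rewrite -rmorphXn.
- by move=> k; rewrite (elem_sum_weights bVw) rmorph_elem_sym -map_comp.
- move=> perf; rewrite big_map big_enum /=; under eq_bigr do rewrite evt.
  rewrite exchange_big big1 // => j _.
  by rewrite -mulr_suml (sum_weights_perfect bVw) // mul0r.
Qed.

Lemma power_sum_growth (s : nat -> seq F) (C N : nat) :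
    (forall m, (size (s m) <= (C * m).+1 ^ N)%N) ->
    (forall m, {in s m, forall x, `|x| <= (C * m)%:R}) ->
  forall k, exists B : nat, forall m, `|\sum_(x <- s m) x ^+ k| <= (B * m.+1 ^ (N + k))%:R.
Proof.
move=> sC xC k; exists (C.+1 ^ N * C ^ k)%N => m.
apply: (@le_trans _ _ ((size (s m))%:R * (C * m)%:R ^+ k)).
  rewrite mulr_natl -iter_addr_0 -(count_predT (s m)) -big_const_seq.
  apply: le_trans (ler_norm_sum _ _ _) _; rewrite big_seq [leRHS]big_seq.
  by apply: ler_sum => x xs; rewrite normrX lerXn2r ?nnegrE // xC.
rewrite -natrX -natrM ler_nat expnD mulnACA -!expnMn leq_mul //.
  by apply: leq_trans (sC m) _; case: (N) => // N'; rewrite leq_exp2r //; nia.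
by case: (k) => // k'; rewrite leq_exp2r // leq_mul2l leqnSn orbT.
Qed.

Theorem degree_bounds k (Pk Ek : symA t) (N := #|` Phip|) :
    extends_dominant Phip Pk (fun lambda => power_sum t k (phi lambda)) ->
    extends_dominant Phip Ek (fun lambda => elem_sum t k (phi lambda)) ->
    [/\ deg_le Pk (N + k)%N,
        deg_le Ek (k * (N + 1))%N
      & semisimple g -> deg_le Ek (k %/ 2 * N + k)%N].
Proof.
move=> eP eE; split.
- apply: (degree_of_growth eP) => lambda a dl.
  have [C [s sP]] := weights_growth a dl.
  have [|m x|B BP] := @power_sum_growth s C N _ _ k; [by move=> m; case: (sP m)|by case: (sP m) => _ + _ _ _; apply|].
  by exists B => m; have [_ _ -> _ _] := sP m.
- apply: (degree_of_growth eE) => lambda a dl.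
  have [C [s sP]] := weights_growth a dl.
  have pB i := @power_sum_growth s C N (fun m => let: And5 H _ _ _ _ := sP m in H)
    (fun m => let: And5 _ H _ _ _ := sP m in H) i.+1.
  have [|B BP] := @elem_sym_growth _ s N (fun k => k * (N + 1))%N pB _ k.
    (* The two sides of the required inequality differ by i * N. *)
    by move=> l i il; right; nia.
  by exists B => m; have [_ _ _ -> _] := sP m.
- move=> ss; have perf := reductive_semisimple_perfect red ss.
  apply: (degree_of_growth eE) => lambda a dl.
  have [C [s sP]] := weights_growth a dl.
  have pB i := @power_sum_growth s C N (fun m => let: And5 H _ _ _ _ := sP m in H)
    (fun m => let: And5 _ H _ _ _ := sP m in H) i.+1.
  have [|B BP] := @elem_sym_growth _ s N (fun k => k %/ 2 * N + k)%N pB _ k.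
    (* Index 0 is the first power sum, which vanishes. Any other has degree at least 2, so removing
       it lowers the floor of half the degree by at least one, which pays for its factor m^N. *)
    move=> l [|i] il.
      left=> m; have [_ _ _ _ /(_ perf) s0] := sP m.
      by rewrite -[RHS]s0; apply: eq_bigr => x _; rewrite expr1.
    right; have le2 : ((l - i.+1) %/ 2 + 1 <= l.+1 %/ 2)%N by lia.
    apply: (@leq_trans (((l - i.+1) %/ 2 + 1) * N + l.+1)%N); first by rewrite mulnDl; lia.
    by rewrite leq_add2r leq_mul2r le2 orbT.
  by exists B => m; have [_ _ _ -> _] := sP m.
Qed.
End Degrees.

Lemma complex_archimedean (R : realType) : Num.archimedean_axiom R[i].
Proof.
move=> x; have := normr_real x; case: {x}`|x| => a b.
rewrite complex_real /= => /eqP ->.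
exists (Num.bound `|a|).
rewrite -(rmorph_nat (real_complex R)) ltcR.
exact: le_lt_trans (ler_norm a) (archi_boundP (normr_ge0 a)).
Qed.

Theorem proposition6 (R : realType) (g : lieAlgebra R[i]) (t : {vspace g})
    (Phip : {fset 'Hom(subvs_of t, R[i]^o)})
    (phi : 'Hom(subvs_of t, R[i]^o) -> lieRep g) :
  reductive g ->
  cartan_subalgebra t ->
  positive_roots Phip ->
  (forall lambda, dominant Phip lambda ->
     irreducible (phi lambda) /\ highest_weight Phip (phi lambda) lambda) ->
  let N := #|` Phip| in
  forall (k : nat) (Pk Ek : symA t),
    extends_dominant Phip Pk (fun lambda => power_sum t k (phi lambda)) ->
    extends_dominant Phip Ek (fun lambda => elem_sum t k (phi lambda)) ->
    [/\ deg_le Pk (N + k)%N,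
        deg_le Ek (k * (N + 1))%N
      & semisimple g -> deg_le Ek (k %/ 2 * N + k)%N].
Proof.
move=> red car pos phiP N k Pk Ek.
exact: (degree_bounds (@complex_archimedean R) red car pos phiP).
Qed.
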